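(* Let $(\mathcal{X},d)$ be a Polish metric space and let $c(\cdot,\cdot)$ be a cost function on $\mathcal{X}\times\mathcal{X}$ such that $c(x,y)=q(d(x,y))$, where $q:\mathbb{R}^+\to\mathbb{R}^+$ is an increasing convex function satisfying the $\Delta_2$-condition: there exists $K>0$ such that $q(2x)\le Kq(x)$ for all $x\in\mathbb{R}^+$. If $\alpha\in\mathcal{C}$ satisfies assumptions $(A_1)$ and $(A_2)$, then for all $\mu\in\mathcal{P}(\mathcal{X})$ such that $\int_{\mathcal X}c(x_0,x)\,d\mu(x)<+\infty$ for all $x_0\in\mathcal{X}$, the following statements are equivalent: (1) There exists $a>0$ such that for all $\nu\in\mathcal{P}(\mathcal{X})$, $\alpha\left(\frac{\mathcal{T}_c(\nu,\mu)}{a}\right)\le\operatorname{H}(\nu\mid\mu)$. (2) For all $x_0\in\mathcal{X}$, the function $c(x_0,\cdot)$ belongs to $\mathbb{L}_{\tau_\alpha}(\mathcal{X},\mu)$. More precisely, if (2) holds true then one can take $a=\sqrt2\,K\,m_\alpha\inf_{x_0\in\mathcal{X}}\|c(x_0,\cdot)\|_{\tau_\alpha}$ in (1), where $$m_\alpha=e\max\left(\frac{1}{\alpha^{-1}(2)\sqrt{c_{\alpha^\circledast}(1-u)}},\frac1u\right),$$ with $u\in(0,1)$ such that $\frac{u}{\sqrt{1-u}}\le s_{\alpha^\circledast}\sqrt{c_{\alpha^\circledast}}$ and $\frac{u^3}{1-u}\le 2$, the constants $s_{\alpha^\circledast},c_{\alpha^\circledast}$ being those of assumption $(A_2)$. Furthermore,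 if $\operatorname{dom}\alpha=\mathbb{R}^+$, then the following inequality holds: for all $\nu\in\mathcal{P}(\mathcal{X})$, $$\mathcal{T}_c(\nu,\mu)\le\sqrt2\,K\,m_\alpha\inf_{x_0\in\mathcal{X},\,\delta>0}\frac1\delta\left(1+\frac{\log\int_{\mathcal X}e^{\alpha(\delta c(x_0,x))}\,d\mu(x)}{\log2}\right)\alpha^{-1}\left(\operatorname{H}(\nu\mid\mu)\right).$$
   Context: $\mathcal{P}(\mathcal{X})$ is the set of Borel probability measures on $\mathcal{X}$. $\mathcal{T}_c(\nu,\mu)=\inf_\pi\int_{\mathcal X^2}c(x,y)\,d\pi(x,y)$, where $\pi$ runs over all probability measures on $\mathcal{X}\times\mathcal{X}$ with first marginal $\nu$ and second marginal $\mu$. $\operatorname{H}(\nu\mid\mu)=\int_{\mathcal X}\log\frac{d\nu}{d\mu}\,d\nu$ if $\nu\ll\mu$, and $+\infty$ otherwise. $\mathcal{C}$ is the set of convex lower semicontinuous functions $\alpha:\mathbb{R}^+\to\mathbb{R}^+\cup\{+\infty\}$ with $\alpha(0)=0$; by convention $\alpha(+\infty)=\lim_{t\to+\infty}\alpha(t)$, and $\operatorname{dom}\alpha=\{t\ge0:\alpha(t)<+\infty\}$. The monotone conjugate of $\alpha$ is $\alpha^\circledast(s)=\sup_{t\ge0}\{st-\alpha(t)\}$, $s\ge0$. The inverse is $\alpha^{-1}(y)=\sup\{t\ge0:\alpha(t)\le y\}$. Assumption $(A_1)$: $\{s\in\mathbb{R}^+:\alpha^\circledast(s)<+\infty\}=[0,b)$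 for some $b\in(0,+\infty]$. Assumption $(A_2)$: there exist $s_{\alpha^\circledast}>0$ and $c_{\alpha^\circledast}>0$ such that $\alpha^\circledast(s)\ge c_{\alpha^\circledast}s^2$ for all $s\in[0,s_{\alpha^\circledast}]$. $\tau_\alpha:=e^\alpha-1$. $\mathbb{L}_{\tau_\alpha}(\mathcal{X},\mu)$ is the set of measurable $f:\mathcal{X}\to\mathbb{R}$ (modulo $\mu$-a.e. equality) such that $\int_{\mathcal X}\tau_\alpha(|f|/\lambda)\,d\mu<+\infty$ for some $\lambda>0$, with Luxemburg norm $\|f\|_{\tau_\alpha}=\inf\{\lambda>0:\int_{\mathcal X}\tau_\alpha(|f|/\lambda)\,d\mu\le1\}$. In the degenerate case where the explicit constant $a$ is $0$, use the conventions $0/0=0$ and $t/0=+\infty$ for $t>0$. If the infimum in the last inequality is $+\infty$, the right-hand side is read as $+\infty$.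
   Formalization: In m_α the printed α^{-1}(2) is replaced by (α^⊛)^{-1}(2), since the printed constant fails on a two-point space; ''cost function'' is taken to include c(x,x)=0, i.e. q(0)=0, without which (2) need not imply (1); in the last bound 0·∞ is read as +∞. *)

(* Defs.v *)
(* MathComp-Analysis. *)
From HB Require Import structures.
From mathcomp Require Import all_boot all_order all_algebra.
From mathcomp Require Import all_classical all_reals all_analysis.

Set Implicit Arguments.
Unset Strict Implicit.
Unset Printing Implicit Defensive.

Import Order.TTheory GRing.Theory Num.Theory.
Import numFieldNormedType.Exports.

Local Open Scope classical_set_scope.
Local Open Scope ring_scope.
Local Open Scope ereal_scope.

#[short(type="completeMetricType")]
HB.structure Definition CompleteMetric (R : numDomainType) :=
  {T of Metric R T & Complete T}.

Definition separable (X : topologicalType) : Prop :=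
  exists2 D : set X, countable D & dense D.

Definition borel (X : ptopologicalType) := g_sigma_algebraType (@open X).

Section transport.
Context {R : realType} {d : measure_display} {X : measurableType d}.

(* [0 <= c], and staying put is free. *)
Definition cost_function (c : X -> X -> R) : Prop :=
  (forall x y, 0 <= c x y)%R /\ (forall x, c x x = 0%R).

Definition coupling (nu mu : probability X R) : set (probability (X * X)%type R) :=
  [set pi | forall A : set X, measurable A ->
     pi (fst @^-1` A) = nu A /\ pi (snd @^-1` A) = mu A].

Definition transport_cost (c : X -> X -> R) (nu mu : probability X R) : \bar R :=
  ereal_inf [set \int[pi]_z (c z.1 z.2)%:E | pi in coupling nu mu].

Definition relative_entropy (nu mu : probability X R) : \bar R :=
  if `[< nu `<< mu >] then
    \int[nu]_x lne (Radon_Nikodym (charge_of_finite_measure nu) mu x)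
  else +oo.

End transport.

(* Functions on R^+ are represented by functions on R whose values at negative
   reals are never used. *)
Section convex_functions.
Context {R : realType}.
Implicit Types (f alpha : R -> \bar R) (s t u : R) (y : \bar R).

(* Points outside a set are isolated in its [subspace] topology, so lower
   semicontinuity below only concerns [0, +oo[. *)
Definition class_C alpha : Prop :=
  [/\ (forall t, (0 <= t)%R -> 0 <= alpha t),
      alpha 0%R = 0,
      (forall x z t, (0 <= x)%R -> (0 <= z)%R -> (0 <= t <= 1)%R ->
         alpha ((1 - t) * x + t * z)%R
           <= (1 - t)%:E * alpha x + t%:E * alpha z) &
      lower_semicontinuous (alpha : subspace `[0%R, +oo[ -> \bar R)].

Definition edom f : set R := [set t | (0 <= t)%R /\ f t < +oo].

Definition at_ereal f y : \bar R :=
  match y with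
  | t%:E => f t
  | +oo => lim (f t @[t --> +oo%R])
  | -oo => 0
  end.

Definition monotone_conj alpha s : \bar R :=
  ereal_sup [set (s * t)%:E - alpha t | t in [set t | (0 <= t)%R]].

Definition monotone_inv f y : \bar R :=
  ereal_sup [set t%:E | t in [set t | (0 <= t)%R /\ f t <= y]].

Definition assumption_A1 alpha : Prop :=
  exists2 b : \bar R, 0 < b &
    edom (monotone_conj alpha) = [set s | (0 <= s)%R /\ s%:E < b].

(* [sa] and [ca] witness the second assumption. *)
Definition assumption_A2 alpha (sa ca : R) : Prop :=
  [/\ (0 < sa)%R, (0 < ca)%R &
      forall s, (0 <= s <= sa)%R -> (ca * s ^+ 2)%:E <= monotone_conj alpha s].

(* The inverse at 2 is that of the conjugate, not of [alpha]: it is compared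
   with the dual quantity [Num.sqrt ca].  With [monotone_inv alpha 2] the
   constant would not be invariant under [alpha t |-> alpha (t / l)], and the
   transport inequality below would fail for large [l]. *)
Definition m_const alpha (ca u : R) : \bar R :=
  (expR 1)%:E *
  maxe (monotone_inv (monotone_conj alpha) 2%:E
          * (Num.sqrt (ca * (1 - u)))%:E)^-1
       (u^-1)%:E.

(* In extended reals [0 * +oo = 0]; here an infinite factor always gives +oo. *)
Definition mul_top (x y : \bar R) : \bar R :=
  if (x == +oo) || (y == +oo) then +oo else x * y.

End convex_functions.

Section orlicz.
Context {R : realType} {d : measure_display} {X : measurableType d}.
Variables (mu : probability X R) (alpha : R -> \bar R).

Definition tau (t : R) : \bar R := expeR (alpha t) - 1.

Definition orlicz (f : X -> R) : Prop :=
  measurable_fun setT f /\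
  exists2 l : R, (0 < l)%R & \int[mu]_x tau (`|f x| / l)%R < +oo.

Definition luxemburg (f : X -> R) : \bar R :=
  ereal_inf [set l%:E | l in
    [set l | (0 < l)%R /\ \int[mu]_x tau (`|f x| / l)%R <= 1]].

End orlicz.

Section criteria.
Context {R : realType} {d : measure_display} {X : measurableType d}.
Variables (mu : probability X R) (alpha : R -> \bar R) (c : X -> X -> R).

(* The library's [0 / 0 = 0] and [t / 0 = +oo] for [0 < t] in [\bar R] give the
   intended reading when [a = 0]. *)
Definition transport_inequality (a : \bar R) : Prop :=
  forall nu : probability X R,
    at_ereal alpha (transport_cost c nu mu / a) <= relative_entropy nu mu.

Definition inf_luxemburg : \bar R :=
  ereal_inf [set luxemburg mu alpha (c x0) | x0 in [set: X]].

Definition inf_exp_moment : \bar R :=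
  ereal_inf [set (p.2^-1)%:E *
      (1 + lne (\int[mu]_x expeR (alpha (p.2 * c p.1 x)%R)) / (ln 2)%:E)
    | p in [set p : X * R | (0 < p.2)%R]].

End criteria.

(* Main.v *)
Require Import Defs.
From HB Require Import structures.
From mathcomp Require Import all_boot all_order all_algebra.
From mathcomp Require Import all_classical all_reals all_analysis.
From mathcomp Require Import measurable_realfun.
From mathcomp Require Import ring lra.

Set Implicit Arguments.
Unset Strict Implicit.
Unset Printing Implicit Defensive.

Import Order.TTheory GRing.Theory Num.Theory.
Import numFieldNormedType.Exports.

Local Open Scope classical_set_scope.
Local Open Scope ring_scope.
Local Open Scope ereal_scope.

(** Fix a point x0 and write chi for c(x0, .) and phi for the monotone conjugate
    of alpha.

    Sufficiency.  By convexity and doubling of q the cost is dominated by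
    (K / 2) (chi x + chi y).  If nu = f mu, leaving the common part min(f, 1) mu
    of nu and mu in place and coupling the rest independently gives
    T_c(nu, mu) <= (K / 2) * integral of chi |f - 1| dmu
    ([transport_cost_le_weighted_variation]), so a weighted Pinsker inequality is
    enough.  Its integrand is h (f - 1) with h = chi or - chi, and Young's
    inequality for the entropy reduces it to a bound on the exponential moments
    of the centred variable h - E h ([weighted_transport_entropy]).  When
    exp (alpha (chi / l)) has integral at most 2 these moments are at most
    exp (phi (C l s)), for a pointwise reason ([expR_sub_le_conj]): Young's
    inequality s t <= alpha t + phi s with s near phi^-1(p) bounds t ^ p by
    (p / s) ^ p exp (alpha t), and summing over p against 1 / p! leaves a series
    in s / phi^-1(p).  That series is at most exp (phi (m s)) - 1: for small s it
    is geometric and of order s ^ 2, where the quadratic lower bound of phi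
    applies, and for large s convexity of phi compares it with the exponential
    series.  The two regimes produce the two terms in the maximum defining the
    constant.

    The outcome is s T <= a (H + phi s) for all s > 0, where a is proportional
    to l ([dual_transport_entropy]).  Biconjugation turns this into
    alpha (T / a) <= H ([monotone_biconj_le]), and since it is linear in a it
    survives infima over x0 and l ([dual_transport_inequality_inf]), even when
    the infimum is 0.  The bound by exponential moments follows from
    l <= (1 + ln M / ln 2) / delta when exp (alpha (delta chi)) has integral M
    ([integral_expeR_rescale]).

    Necessity.  Let nu be mu conditioned on chi >= t.  Its relative entropy is
    - ln mu(chi >= t), and its transport cost to mu is at least
    2 t / K - integral of chi dmu, because all its mass is far from x0.  The
    transport inequality thus says that mu(chi >= t) is at most
    exp (- alpha (t / (K a))) for t large, which makes exp (alpha (chi / l))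
    integrable for l large enough ([orlicz_of_transport_inequality]). *)

(** * Inequalities for the exponential *)

Section exponential_inequalities.
Context {R : realType}.
Implicit Types a b h m x y z f u L : R.
Local Open Scope ring_scope.

Lemma sum_exp_coeff_le_expR x n :
  0 <= x -> \sum_(0 <= i < n) x ^+ i / i`!%:R <= expR x.
Proof.
move=> x0; rewrite /expR.
have e0 i : 0 <= exp_coeff x i by exact: exp_coeff_ge0.
by apply: (nondecreasing_cvgn_le (nondecreasing_series (fun i _ _ => e0 i))
  (is_cvg_series_exp_coeff x)).
Qed.

Lemma expR_le_sum_exp_coeff x z :
  (forall n, \sum_(0 <= i < n) x ^+ i / i`!%:R <= z) -> expR x <= z.
Proof.
move=> xz; rewrite /expR; apply: limr_le; first exact: is_cvg_series_exp_coeff.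
by apply: nearW => n; exact: xz.
Qed.

(** The exponential without its linear term.  That term integrates to 0 for a
    centred variable, and the rest increases on the positive reals and dominates
    exp (- x) + x there, so that centring can be undone by the triangle
    inequality. *)
Definition expR_sub x : R := expR x - x.

Lemma expR_sub_homo x y : 0 <= x -> x <= y -> expR_sub x <= expR_sub y.
Proof.
move=> x0 xy; rewrite /expR_sub.
have -> : y = x + (y - x) by ring.
rewrite expRD.
have e1 : 1 <= expR x by rewrite (le_trans _ (expR_ge1Dx x))// lerDl.
have := expR_ge1Dx (y - x); nra.
Qed.

Lemma expR_le_DexpR_sub y : expR y <= y + expR_sub `|y|.
Proof.
rewrite /expR_sub.
have [y0|y0] := leP 0 y; first by rewrite ger0_norm//; lra.
rewrite ltr0_norm//; set t := - y.
have t0 : 0 < t by rewrite /t; lra.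
have -> : y = - t by rewrite /t; ring.
rewrite expRN.
have e2 : 1 + t + t ^+ 2 / 2 <= expR t.
  have := @sum_exp_coeff_le_expR t 3 (ltW t0).
  (* the first three terms of the exponential series *)
  rewrite 3?big_nat_recr//= big_geq// !factS fact0 expr0 expr1 => H.
  by apply: le_trans H; rewrite !muln1 /=; lra.
have eI : (expR t)^-1 * expR t = 1 by rewrite mulVf// gt_eqF// expR_gt0.
have i0 : 0 < (expR t)^-1 by rewrite invr_gt0 expR_gt0.
move: eI i0 e2; set i := _^-1; set e := expR t => eI i0 e2.
suff : 0 <= e * (e - 2 * t - i).
  have e0 : 0 < e by apply: expR_gt0.
  rewrite pmulr_rge0//; lra.
have -> : e * (e - 2 * t - i) = e ^+ 2 - 2 * t * e - 1 by rewrite -eI; ring.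
have : (1 + t ^+ 2 / 2) ^+ 2 <= (e - t) ^+ 2.
  by rewrite lerXn2r ?nnegrE; nra.
have t4 : 0 <= t ^+ 4 by rewrite exprn_ge0// ltW.
have -> : (1 + t ^+ 2 / 2) ^+ 2 = 1 + t ^+ 2 + t ^+ 4 / 4 by field.
nra.
Qed.

Lemma expR_sub_midpoint a b :
  expR_sub (a + b) <= (expR_sub (2 * a) + expR_sub (2 * b)) / 2.
Proof.
rewrite /expR_sub !mulrDl !mul1r !expRD.
have := sqr_ge0 (expR a - expR b); nra.
Qed.

(** The midpoint inequality separates the variable h from its mean m, at the price
    of doubling both. *)
Lemma expR_centered_le h m a b : `|h| <= a -> `|m| <= b ->
  expR (h - m) <= h - m + (expR_sub (2 * a) + expR_sub (2 * b)) / 2.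
Proof.
move=> ha mb; apply: (le_trans (expR_le_DexpR_sub _)); rewrite lerD2l.
apply: (le_trans _ (expR_sub_midpoint a b)); apply: expR_sub_homo => //.
by rewrite (le_trans (ler_normB _ _))// lerD.
Qed.

Lemma expR_sub_tangent x y : expR y - y + (expR y - 1) * (x - y) <= expR_sub x.
Proof.
rewrite /expR_sub -[in expR x](subrK y x) (addrC (x - y)) expRD.
by have := expR_ge1Dx (x - y); have := expR_gt0 y; nra.
Qed.

(** Duality between x ln x - x and the exponential, shifted by a free constant L
    which will be a bound on the log-Laplace transform of y. *)
Lemma entropy_young y f L : 0 <= f ->
  y * f <= f * ln f - f + expR (y - L) + L * f.
Proof.
rewrite le_eqVlt => /predU1P[<-|f0].
  by have := expR_gt0 (y - L); nra.
have := expR_ge1Dx (y - L - ln f); rewrite expRB lnK ?posrE//.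
have f1 : f^-1 * f = 1 by rewrite mulVf// gt_eqF.
have f'0 : 0 < f^-1 by rewrite invr_gt0.
move: (expR _) => e; move: (ln f) => l.
have -> : e / f = f^-1 * e by ring.
move: f1 f'0; move: f^-1 => g f1 g0 H.
have := ler_wpM2l (ltW f0) H.
have -> : f * (g * e) = e by rewrite mulrA (mulrC f) f1 mul1r.
nra.
Qed.

Lemma expr_div_fact_le_expR p : p%:R ^+ p / p`!%:R <= expR (p%:R : R).
Proof.
apply: le_trans (@sum_exp_coeff_le_expR p%:R p.+1 (ler0n _ _)).
by rewrite big_nat_recr//= lerDr; apply: sumr_ge0 => i _; rewrite divr_ge0// exprn_ge0.
Qed.

(** For fixed p the ratio of z ^ p to exp z is largest at z = p. *)
Lemma expr_le_expR p z : (0 < p)%N -> 0 <= z ->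
  z ^+ p <= p%:R ^+ p * expR (z - p%:R).
Proof.
move=> p0 z0.
have q0 : (0 : R) < p%:R by rewrite ltr0n.
have zp : z / p%:R <= expR (z / p%:R - 1).
  by have := expR_ge1Dx (z / p%:R - 1); rewrite addrC subrK.
have : (z / p%:R) ^+ p <= expR (z / p%:R - 1) ^+ p.
  by rewrite lerXn2r ?nnegrE ?divr_ge0 ?expR_ge0// ltW.
rewrite -expRM_natl mulrBr mulr1 mulrCA divff ?gt_eqF// mulr1.
rewrite expr_div_n ler_pdivrMr ?exprn_gt0//.
by rewrite mulrC.
Qed.

Lemma geometric_tail_le u k n : 0 <= u -> u < 1 ->
  \sum_(k <= i < n) u ^+ i <= u ^+ k / (1 - u).
Proof.
move=> u0 u1; have u1' : 0 < 1 - u by rewrite subr_gt0.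
have [kn|nk] := leqP k n; last first.
  by rewrite big_geq 1?ltnW// divr_ge0 ?exprn_ge0// ltW.
rewrite ler_pdivlMr// mulrC big_distrr/=.
have -> : \sum_(k <= i < n) (1 - u) * u ^+ i = - \sum_(k <= i < n) (u ^+ i.+1 - u ^+ i).
  by rewrite -sumrN; apply: eq_bigr => i _; rewrite exprS; ring.
by rewrite telescope_sumr// opprB lerBlDr lerDl exprn_ge0.
Qed.

End exponential_inequalities.

(** * Monotone conjugates of convex functions *)

Section monotone_conjugate.
Context {R : realType}.
Implicit Types (alpha : R -> \bar R) (s t u : R).

Lemma fenchel_young alpha s t : (0 <= t)%R ->
  (s * t)%:E - alpha t <= monotone_conj alpha s.
Proof. by move=> t0; apply: ereal_sup_ubound; exists t. Qed.

Lemma monotone_conj_le alpha s (y : \bar R) :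
  (forall t, (0 <= t)%R -> (s * t)%:E <= alpha t + y) ->
  monotone_conj alpha s <= y.
Proof.
move=> H; apply: ge_ereal_sup => _ [t t0 <-].
move: (H t t0) => {H}; case: (alpha t) => [r| |]//=; case: y => [y| |]//= H;
  rewrite ?leey ?leNye//.
by move: H; rewrite !lee_fin; lra.
Qed.

Lemma monotone_conj_homo alpha s u : (s <= u)%R ->
  monotone_conj alpha s <= monotone_conj alpha u.
Proof.
move=> su; apply: ge_ereal_sup => _ [t t0 <-].
apply: le_trans (fenchel_young alpha u t0).
by rewrite leeD2r// lee_fin ler_wpM2r.
Qed.

Variable alpha : R -> \bar R.
Hypothesis Calpha : class_C alpha.

Lemma class_C_ge0 t : (0 <= t)%R -> 0 <= alpha t.
Proof. by case: Calpha => + _ _ _; exact. Qed.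

Lemma class_C0 : alpha 0%R = 0.
Proof. by case: Calpha. Qed.

Lemma class_C_scale t u : (0 <= t)%R -> (0 <= u <= 1)%R ->
  alpha (u * t)%R <= u%:E * alpha t.
Proof.
move=> t0 u01; case: Calpha => _ a0 cvx _.
by have := cvx 0%R t u (lexx _) t0 u01; rewrite mulr0 add0r a0 mule0 add0e.
Qed.

Lemma class_C_homo s t : (0 <= s)%R -> (s <= t)%R -> alpha s <= alpha t.
Proof.
move=> s0; rewrite le_eqVlt => /predU1P[->//|st].
have t0 : (0 < t)%R by exact: le_lt_trans st.
have st01 : (0 <= s / t <= 1)%R.
  by rewrite divr_ge0 ?(ltW t0)//= ler_pdivrMr// mul1r ltW.
have := class_C_scale (ltW t0) st01; rewrite divfK ?gt_eqF// => /le_trans; apply.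
have := class_C_ge0 (ltW t0); case/andP: st01 => *.
by rewrite gee_pMl ?lee_fin.
Qed.

Lemma monotone_conj_ge0 s : 0 <= monotone_conj alpha s.
Proof. by have := fenchel_young alpha s (lexx _); rewrite mulr0 class_C0 sube0. Qed.

Lemma monotone_conj0 : monotone_conj alpha 0%R = 0.
Proof.
apply/eqP; rewrite eq_le monotone_conj_ge0 andbT.
apply: monotone_conj_le => t t0; rewrite mul0r adde0; exact: class_C_ge0.
Qed.

Lemma fenchel_youngD s t : (0 <= t)%R ->
  (s * t)%:E <= alpha t + monotone_conj alpha s.
Proof.
move=> t0; have := fenchel_young alpha s t0; have := class_C_ge0 t0.
have := monotone_conj_ge0 s.
case: (alpha t) => [r| |]//=; case: (monotone_conj alpha s) => [r'| |]//= _ _;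
  rewrite ?leey//.
by rewrite !lee_fin; lra.
Qed.

Lemma monotone_conj_scale s u : (0 <= u <= 1)%R ->
  monotone_conj alpha (u * s) <= u%:E * monotone_conj alpha s.
Proof.
move=> /andP[u0 u1]; apply: monotone_conj_le => t t0.
have fy := fenchel_youngD s t0; have a0 := class_C_ge0 t0.
have c0 := monotone_conj_ge0 s.
move: u0; rewrite le_eqVlt => /predU1P[<-|u0].
  by rewrite mul0e !mul0r adde0.
case: (monotone_conj alpha s) c0 fy => [r'| |]//= _ fy; last first.
  by rewrite gt0_muley ?lte_fin// addey ?leey// gt_eqF// (lt_le_trans _ a0).
case: (alpha t) a0 fy => [r| |]//= x0 fy; last by rewrite leey.
by move: x0 fy; rewrite -EFinM -!EFinD !lee_fin => x0 fy; nra.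
Qed.

(** Half of the Fenchel-Moreau theorem.  If alpha t exceeds H1 > H, the line
    through (t, H1) whose slope is the supremum of the slopes towards points on
    the left lies below alpha: on the left by choice of the slope, on the right by
    convexity.  Lower semicontinuity makes the supremum finite. *)
Lemma monotone_biconj_le t (H : R) : (0 <= t)%R ->
  (forall s (L : R), (0 <= s)%R -> monotone_conj alpha s <= L%:E ->
     (s * t <= H + L)%R) ->
  alpha t <= H%:E.
Proof.
move=> t0 Hs; case: (Calpha) => _ _ cvx lsc.
have H0 : (0 <= H)%R.
  have := Hs 0%R 0%R (lexx _); rewrite monotone_conj0 => /(_ (lexx _)).
  by rewrite mul0r addr0.
move: t0; rewrite le_eqVlt => /predU1P[<-|t0]; first by rewrite class_C0 lee_fin.
rewrite leNgt; apply/negP => Ht.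
have [H1 HH1 H1t] : exists2 H1 : R, (H < H1)%R & H1%:E < alpha t.
  case: (alpha t) Ht => [r| |]//=; rewrite ?lte_fin => Hr.
  - by exists ((H + r) / 2)%R; rewrite ?lte_fin; lra.
  - by exists (H + 1)%R; rewrite ?ltry; lra.
have [t1 /andP[t10 t1t] H1r] : exists2 t1 : R, (0 <= t1 < t)%R &
    forall r, (t1 < r <= t)%R -> H1%:E < alpha r.
  have [V] := lsc t H1 H1t.
  rewrite -[nbhs _]/(nbhs_subspace _) -nbhs_subspace_in; last first.
    by rewrite /= in_itv/= andbT ltW.
  move=> [e /= e0 eV] VH.
  exists (Num.max 0 (t - e / 2))%R; first by rewrite le_max lexx/= gt_max t0; lra.
  move=> r /andP[]; rewrite gt_max => /andP[r0 er] rt.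
  apply: VH; apply: eV => /=; last by rewrite in_itv/= andbT ltW.
  by rewrite ger0_norm ?subr_ge0//; lra.
have H10 : (0 < H1)%R by exact: le_lt_trans HH1.
pose E := [set z : R | exists r x : R,
  [/\ (0 <= r < t)%R, alpha r = x%:E & z = ((H1 - x) / (t - r))%R]].
have E0 : E !=set0.
  by exists ((H1 - 0) / (t - 0))%R, 0%R, 0%R; rewrite lexx t0 class_C0.
have Eub z : E z -> (z <= H1 / (t - t1))%R.
  move=> [r [x [/andP[r0 rt] arx ->]]]; rewrite ler_pdivrMr ?subr_gt0//.
  have x0 : (0 <= x)%R by have := class_C_ge0 r0; rewrite arx lee_fin.
  have tt1 : (0 < t - t1)%R by rewrite subr_gt0.
  have [rt1|t1r] := leP r t1.
    rewrite mulrAC ler_pdivlMr//; nra.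
  have : H1%:E < alpha r by apply: H1r; rewrite t1r ltW.
  rewrite arx lte_fin => H1x.
  apply: (@le_trans _ _ 0%R); first lra.
  by rewrite mulr_ge0 ?divr_ge0 ?(ltW H10) ?(ltW tt1)// subr_ge0 ltW.
have supE : has_sup E by split => //; exists (H1 / (t - t1))%R.
set s := sup E.
have sE z : E z -> (z <= s)%R by move=> Ez; exact: sup_ubound supE.2 _ Ez.
have s0 : (0 <= s)%R.
  apply: (@le_trans _ _ ((H1 - 0) / (t - 0)))%R.
    by rewrite !subr0 divr_ge0// ltW.
  by apply: sE; exists 0%R, 0%R; rewrite lexx t0 class_C0.
have : monotone_conj alpha s <= (s * t - H1)%:E.
  apply: monotone_conj_le => r r0; have := class_C_ge0 r0.
  case arx : (alpha r) => [x| |]//= x0; last by rewrite leey.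
  rewrite -EFinD lee_fin.
  have [rt|tr|rt] := ltgtP r t; last first.
  - by move: H1t; rewrite -rt arx lte_fin; lra.
  - have tr0 : (0 < r - t)%R by rewrite subr_gt0.
    suff : (s <= (x - H1) / (r - t))%R by rewrite ler_pdivlMr//; nra.
    apply: ge_sup => // z [r' [x' [/andP[r'0 r't] arx' ->]]].
    have tr'0 : (0 < t - r')%R by rewrite subr_gt0.
    have rr'0 : (0 < r - r')%R by lra.
    rewrite ler_pdivrMr// mulrAC ler_pdivlMr//.
    have th01 : (0 <= (t - r') / (r - r') <= 1)%R.
      by rewrite divr_ge0 ?(ltW tr'0) ?(ltW rr'0)//= ler_pdivrMr//; lra.
    have := cvx r' r ((t - r') / (r - r'))%R r'0 r0 th01.
    have -> : ((1 - (t - r') / (r - r')) * r' + (t - r') / (r - r') * r = t)%R.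
      by field; rewrite gt_eqF.
    move/(lt_le_trans H1t); rewrite arx arx' -!EFinM -EFinD lte_fin.
    have -> : ((1 - (t - r') / (r - r')) * x' + (t - r') / (r - r') * x =
      ((r - t) * x' + (t - r') * x) / (r - r'))%R.
      by field; rewrite gt_eqF.
    rewrite ltr_pdivlMr//; nra.
  - have : ((H1 - x) / (t - r) <= s)%R by apply: sE; exists r, x; rewrite r0 rt.
    by rewrite ler_pdivrMr ?subr_gt0//; nra.
by move/(Hs _ _ s0); lra.
Qed.

Variables (sa ca : R).
Hypothesis A1 : assumption_A1 alpha.
Hypothesis A2 : assumption_A2 alpha sa ca.

Lemma monotone_conj_fin_near0 : exists2 s : R, (0 < s)%R &
  exists2 L : R, (0 <= L)%R & monotone_conj alpha s = L%:E.
Proof.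
have [b b0 domE] := A1.
have [s s0 sb] : exists2 s : R, (0 < s)%R & s%:E < b.
  case: b b0 {domE} => [r| |]//=; last by exists 1%R => //; rewrite ltry.
  by rewrite lte_fin => r0; exists (r / 2)%R; rewrite ?lte_fin; lra.
have : edom (monotone_conj alpha) s by rewrite domE; split=> //; exact: ltW.
move=> [_]; have := monotone_conj_ge0 s.
by case E : (monotone_conj alpha s) => [L| |]// L0 _; exists s => //; exists L.
Qed.

Lemma monotone_conj_gt0 s : (0 < s)%R -> 0 < monotone_conj alpha s.
Proof.
move=> s0; have [sa0 ca0 H] := A2.
apply: (@lt_le_trans _ _ (monotone_conj alpha (Num.min s sa))); last first.
  by apply: monotone_conj_homo; rewrite ge_min lexx.
have m0 : (0 < Num.min s sa)%R by rewrite lt_min s0.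
apply: lt_le_trans (H _ _); first by rewrite lte_fin mulr_gt0// exprn_gt0.
by rewrite (ltW m0)/= ge_min lexx orbT.
Qed.

(** If alpha were infinite on the positive reals, its conjugate would vanish. *)
Lemma class_C_fin_near0 : exists2 t : R, (0 < t)%R &
  exists2 x : R, (0 <= x)%R & alpha t = x%:E.
Proof.
apply: contrapT => nex.
have [sa0 _ _] := A2.
have := monotone_conj_gt0 sa0; apply/negP; rewrite -leNgt.
apply: monotone_conj_le => t; rewrite le_eqVlt => /predU1P[<-|t0].
  by rewrite mulr0 class_C0 adde0.
have := class_C_ge0 (ltW t0).
case at_ : (alpha t) => [x| |]//= x0; last by rewrite leey.
by exfalso; apply: nex; exists t => //; exists x.
Qed.

(** The conjugate vanishes at 0, is finite to the right of 0 and unbounded, so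
    its inverse at a positive level is a positive real; the supremum is attained
    because a supremum of affine functions is lower semicontinuous. *)
Lemma monotone_inv_conj y : (0 < y)%R -> exists2 p : R, (0 < p)%R &
  [/\ monotone_inv (monotone_conj alpha) y%:E = p%:E,
      monotone_conj alpha p <= y%:E &
      forall s, (p < s)%R -> y%:E < monotone_conj alpha s].
Proof.
move=> y0.
have [sa0 _ _] := A2.
set S := [set t%:E | t in [set t : R | (0 <= t)%R /\ monotone_conj alpha t <= y%:E]].
have Sub s : monotone_conj alpha s <= y%:E -> s%:E <= monotone_inv (monotone_conj alpha) y%:E.
  move=> Hs; have [s0|s0] := leP 0%R s; first by apply: ereal_sup_ubound; exists s.
  apply: (@le_trans _ _ 0%:E); first by rewrite lee_fin ltW.
  by apply: ereal_sup_ubound; exists 0%R => //; split=> //; rewrite monotone_conj0 lee_fin ltW.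
have [s0 s00 [L L0 sL]] := monotone_conj_fin_near0.
(* scaling down a point where the conjugate is finite reaches the level y *)
have lb : exists2 p0 : R, (0 < p0)%R & monotone_conj alpha p0 <= y%:E.
  exists (y / (y + L) * s0)%R; first by rewrite !mulr_gt0// invr_gt0 ltr_wpDr.
  have yL : (0 < y + L)%R by rewrite ltr_wpDr.
  have h01 : (0 <= y / (y + L) <= 1)%R.
    by rewrite divr_ge0 ?(ltW y0) ?(ltW yL)//= ler_pdivrMr//; lra.
  apply: le_trans (monotone_conj_scale _ h01) _; rewrite sL -EFinM lee_fin.
  rewrite mulrAC ler_pdivrMr//; nra.
(* by convexity the conjugate grows at least linearly beyond sa *)
have ub : exists B : R, forall s, monotone_conj alpha s <= y%:E -> (s <= B)%R.
  have := monotone_conj_gt0 sa0; case E : (monotone_conj alpha sa) => [l| |]//; last first.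
    move=> _; exists sa => s Hs; rewrite leNgt; apply/negP => /ltW/monotone_conj_homo.
    by move=> /(_ alpha)/le_trans/(_ Hs); rewrite E.
  rewrite lte_fin => l0; exists (Num.max sa (y * sa / l))%R => s Hs.
  have [ss|ss] := leP s sa; first by rewrite le_max ss.
  rewrite le_max; apply/orP; right; rewrite ler_pdivlMr//.
  have s_gt0 : (0 < s)%R by lra.
  have h01 : (0 <= sa / s <= 1)%R.
    by rewrite divr_ge0 ?(ltW sa0) ?(ltW s_gt0)//= ler_pdivrMr// mul1r ltW.
  have := monotone_conj_scale s h01; rewrite divfK ?gt_eqF// E.
  have := monotone_conj_ge0 s; move: Hs; case: (monotone_conj alpha s) => [v| |]//.
  rewrite -EFinM !lee_fin => vy v0; rewrite mulrAC ler_pdivlMr//; nra.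
have [B HB] := ub; have [p0 p00 Hp0] := lb.
have : monotone_inv (monotone_conj alpha) y%:E <= B%:E.
  by apply: ge_ereal_sup => _ [t [t0 ty] <-]; rewrite lee_fin; exact: HB.
have := Sub _ Hp0.
case E : (monotone_inv (monotone_conj alpha) y%:E) => [p| |]//.
rewrite !lee_fin => p0p _.
exists p; first exact: lt_le_trans p0p.
split=> //; last first.
  move=> s ps; rewrite ltNge; apply/negP => /Sub; rewrite E lee_fin.
  by rewrite leNgt ps.
apply: monotone_conj_le => t t0; have := class_C_ge0 t0.
case at_ : (alpha t) => [x| |]//= x0; last by rewrite leey.
rewrite -EFinD lee_fin; move: t0; rewrite le_eqVlt => /predU1P[<-|t0].
  by rewrite mulr0; move: x0; rewrite lee_fin; lra.
rewrite -ler_pdivlMr// -lee_fin -E.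
apply: ge_ereal_sup => _ [s [s_ge0 Hs] <-]; rewrite lee_fin ler_pdivlMr//.
have := fenchel_youngD s (ltW t0); rewrite at_ -lee_fin => /le_trans; apply.
by rewrite EFinD leeD2l.
Qed.

End monotone_conjugate.

(** * Exponential moments controlled by the conjugate *)

Section moment_generating_bound.
Context {R : realType}.
Variables (alpha : R -> \bar R) (sa ca u : R).
Hypothesis Calpha : class_C alpha.
Hypothesis A1 : assumption_A1 alpha.
Hypothesis A2 : assumption_A2 alpha sa ca.
Hypothesis u01 : (0 < u < 1)%R.
Hypothesis u_sa : (u / Num.sqrt (1 - u) <= sa * Num.sqrt ca)%R.
Hypothesis u3 : (u ^+ 3 / (1 - u) <= 2)%R.

(** Maximizing t ^ p exp (- s t) over t gives (p / s) ^ p e ^ (- p); then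
    s t <= alpha t + p, and p ^ p / p! <= e ^ p. *)
Lemma moment_le (p : nat) (r s t x : R) : (2 <= p)%N -> (0 <= r)%R ->
  (0 < s)%R -> monotone_conj alpha s <= p%:R%:E -> (0 <= t)%R ->
  alpha t = x%:E ->
  ((r * t) ^+ p / p`!%:R <=
     expR x / 2 * (Num.sqrt 2 * expR 1 * r / s) ^+ p)%R.
Proof.
move=> p2 r0 s0 sp t0 atx.
have st0 : (0 <= s * t)%R by rewrite mulr_ge0// ltW.
have stx : (s * t <= x + p%:R)%R.
  rewrite -lee_fin EFinD; apply: le_trans (fenchel_youngD Calpha s t0) _.
  by rewrite atx leeD2l.
have -> : (r * t = r / s * (s * t))%R by field; rewrite gt_eqF.
set rs := (r / s)%R.
have -> : (Num.sqrt 2 * expR 1 * r / s = Num.sqrt 2 * (expR 1 * rs))%R by rewrite /rs; ring.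
have rs_ge0 : (0 <= rs)%R by rewrite divr_ge0// ltW.
clearbody rs; rewrite !exprMn.
have : (s ^+ p * t ^+ p <= p%:R ^+ p * expR x)%R.
  rewrite -exprMn; apply: le_trans (expr_le_expR (ltnW p2) st0) _.
  by rewrite ler_wpM2l ?exprn_ge0// ler_expR lerBlDr.
have := @expr_div_fact_le_expR R p.
have f0 : (0 < p`!%:R :> R)%R by rewrite ltr0n fact_gt0.
rewrite ler_pdivrMr// => pe ste.
rewrite ler_pdivrMr//.
have rs0 : (0 <= rs ^+ p)%R by rewrite exprn_ge0.
apply: le_trans (ler_wpM2l rs0 ste) _.
have x0 := expR_gt0 x.
apply: (@le_trans _ _ (rs ^+ p * (expR p%:R * p`!%:R * expR x)))%R.
  by rewrite ler_wpM2l// ler_wpM2r// ltW.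
rewrite -expRM_natl mulr1.
(* the factor sqrt 2 per power is there to absorb a factor 2, as p >= 2 *)
have s2 : (2 <= Num.sqrt (2 : R) ^+ p)%R.
  have s1 : (1 <= Num.sqrt (2 : R))%R by rewrite -[leLHS]sqrtr1 ler_sqrt//; lra.
  apply: le_trans (ler_weXn2l s1 p2); rewrite sqr_sqrtr//.
have : (0 <= rs ^+ p * (expR p%:R * p`!%:R * expR x))%R.
  by rewrite !mulr_ge0// ltW.
move=> z0.
have -> : (expR x / 2 * (Num.sqrt 2 ^+ p * (expR p%:R * rs ^+ p)) * p`!%:R =
  (Num.sqrt 2 ^+ p) / 2 * (rs ^+ p * (expR p%:R * p`!%:R * expR x)))%R by ring.
by rewrite ler_peMl// ler_pdivlMr//; lra.
Qed.

Variable psi2 : R.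
Hypothesis psi2_gt0 : (0 < psi2)%R.
Hypothesis conj_psi2 : monotone_conj alpha psi2 <= 2%:E.
Hypothesis conj_gt_psi2 : forall s, (psi2 < s)%R -> 2%:E < monotone_conj alpha s.

Let m : R := Num.max (psi2 * Num.sqrt (ca * (1 - u)))^-1%R u^-1%R.

Let u0 : (0 < u)%R. Proof. by case/andP: u01. Qed.
Let u1 : (0 < 1 - u)%R. Proof. by case/andP: u01 => _; rewrite subr_gt0. Qed.
Let sa0 : (0 < sa)%R. Proof. by case: A2. Qed.
Let ca0 : (0 < ca)%R. Proof. by case: A2. Qed.

(** For g <= u psi2 all terms can use the same point psi2, so the series is
    geometric of ratio at most u and has the size of its first term, a square. *)
Lemma geometric_moments_le g L : (0 <= g)%R -> (g <= u * psi2)%R ->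
  monotone_conj alpha (m * g) <= L%:E ->
  forall n, (\sum_(2 <= p < n) (g / psi2) ^+ p <= expR L - 1)%R.
Proof.
move=> g0 gu gL n; set v := (g / psi2)%R.
have v0 : (0 <= v)%R by rewrite divr_ge0// ltW.
have vu : (v <= u)%R by rewrite ler_pdivrMr.
have v1 : (v < 1)%R by apply: le_lt_trans vu _; rewrite -subr_gt0.
apply: le_trans (geometric_tail_le 2 n v0 v1) _.
apply: (@le_trans _ _ (v ^+ 2 / (1 - u)))%R.
  rewrite ler_wpM2l ?exprn_ge0// lef_pV2 ?posrE ?subr_gt0//; last by rewrite -subr_gt0.
  lra.
apply: (@le_trans _ _ L); last by have := expR_ge1Dx L; lra.
rewrite -lee_fin; apply: le_trans gL.
set q := Num.sqrt (ca * (1 - u)).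
have q0 : (0 < q)%R by rewrite sqrtr_gt0 mulr_gt0.
apply: (@le_trans _ _ (monotone_conj alpha ((psi2 * q)^-1 * g))); last first.
  by apply: monotone_conj_homo; rewrite ler_wpM2r// le_max lexx.
have -> : ((psi2 * q)^-1 * g = v / q)%R.
  by rewrite /v; field; rewrite !gt_eqF.
have [_ _ H] := A2.
apply: le_trans (H (v / q)%R _); last first.
  rewrite divr_ge0 ?(ltW q0)//= ler_pdivrMr//; apply: (le_trans vu).
  by rewrite /q sqrtrM ?(ltW ca0)// mulrA -ler_pdivrMr ?sqrtr_gt0.
rewrite lee_fin (expr_div_n v) sqr_sqrtr; last by rewrite mulr_ge0 ?(ltW ca0) ?(ltW u1).
by rewrite le_eqVlt; apply/orP; left; apply/eqP; field; rewrite !gt_eqF.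
Qed.

(** For g > u psi2 the level T of the conjugate at g / u exceeds 2. By convexity
    the conjugate is at most p at (p / T) (g / u) when p <= T, which turns the
    terms up to T into those of the exponential series of T; the others form a
    geometric tail starting at u ^ 3 and fit in the missing linear term T. *)
Lemma exponential_moments_le g T L : (u * psi2 < g)%R ->
  monotone_conj alpha (g / u) = T%:E -> (T <= L)%R ->
  let s p := (if p%:R <= T then p%:R / T * (g / u) else g / u)%R in
  (forall p, (2 <= p)%N -> (0 < s p)%R /\ monotone_conj alpha (s p) <= p%:R%:E)
  /\ forall n, (\sum_(2 <= p < n) (g / s p) ^+ p <= expR L - 1)%R.
Proof.
move=> gu gT TL s.
have g0 : (0 < g)%R by apply: le_lt_trans gu; rewrite mulr_ge0 ?ltW.
have gu0 : (0 < g / u)%R by rewrite divr_gt0.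
have T2 : (2 < T)%R.
  by rewrite -lte_fin -gT; apply: conj_gt_psi2; rewrite ltr_pdivlMr// mulrC.
have T0 : (0 < T)%R by lra.
split=> [p p2|n].
  have p0 : (0 < p%:R :> R)%R by rewrite ltr0n (leq_trans _ p2).
  rewrite /s; case: ifPn => [pT|].
    split; first by rewrite mulr_gt0// divr_gt0.
    have h01 : (0 <= p%:R / T <= 1)%R.
      by rewrite divr_ge0 ?(ltW p0) ?(ltW T0)//= ler_pdivrMr// mul1r.
    apply: le_trans (monotone_conj_scale Calpha _ h01) _.
    by rewrite gT -EFinM divfK// gt_eqF.
  by rewrite -ltNge => Tp; split=> //; rewrite gT lee_fin ltW.
(* T > 2 means that the terms bounded by u ^ p have p >= 3 *)
pose b p : R := (T ^+ p / p`!%:R + (if (2 < p)%N then u ^+ p else 0))%R.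
apply: (@le_trans _ _ (\sum_(2 <= p < n) b p))%R.
  rewrite big_nat_cond [leRHS]big_nat_cond; apply: ler_sum => p.
  rewrite andbT => /andP[p2 _].
  have p0 : (0 < p%:R :> R)%R by rewrite ltr0n (leq_trans _ p2).
  have f0 : (0 < p`!%:R :> R)%R by rewrite ltr0n fact_gt0.
  rewrite /s /b; case: ifPn => [pT|].
    have -> : (g / (p%:R / T * (g / u)) = u * T / p%:R)%R.
      by field; rewrite !gt_eqF.
    apply: (@le_trans _ _ (T ^+ p / p`!%:R))%R; last first.
      by rewrite lerDl; case: ifP => // _; rewrite exprn_ge0// ltW.
    rewrite expr_div_n ler_pM ?invr_ge0 ?exprn_ge0 ?mulr_ge0 ?(ltW u0) ?(ltW T0) ?(ltW p0)//.
      rewrite lerXn2r ?nnegrE ?mulr_ge0 ?(ltW T0) ?(ltW u0)//.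
      by rewrite ler_piMl ?(ltW T0)// ltW// -subr_gt0.
    rewrite lef_pV2 ?posrE ?exprn_gt0// -natrX ler_nat.
    elim: (p) => // k ih; rewrite factS expnS leq_mul// (leq_trans ih)//.
    by case: (k) => // j; rewrite leq_exp2r.
  rewrite -ltNge => Tp.
  have -> : (g / (g / u) = u)%R by field; rewrite !gt_eqF.
  have -> : (2 < p)%N by rewrite -(ltr_nat R) (lt_trans T2).
  by rewrite lerDr divr_ge0 ?exprn_ge0// ltW.
rewrite big_split/=.
apply: (@le_trans _ _ (expR T - 1)%R); last by rewrite lerB// ler_expR.
have sumT : (\sum_(2 <= p < n) T ^+ p / p`!%:R <= expR T - 1 - T)%R.
  have [n2|n2] := leqP n 2; first by rewrite big_geq//; have := expR_ge1Dx T; lra.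
  have := @sum_exp_coeff_le_expR R T n (ltW T0).
  rewrite big_ltn ?(ltn_trans _ n2)// big_ltn ?(ltn_trans _ n2)//.
  by rewrite expr0 expr1 (factS 0) fact0 muln1 !divr1; lra.
have sumu : (\sum_(2 <= p < n) (if (2 < p)%N then u ^+ p else 0) <= 2)%R.
  apply: le_trans u3; apply: le_trans (geometric_tail_le 3 n (ltW u0) _); last by rewrite -subr_gt0.
  have [n2|n2] := leqP n 2; first by rewrite !big_geq// (leq_trans n2).
  rewrite big_ltn//= add0r big_nat_cond [leRHS]big_nat_cond; apply: ler_sum => p.
  by rewrite andbT => /andP[-> _].
lra.
Qed.

(** The conjugate controls the exponential series of r t because each power of t
    is at most a multiple of exp (alpha t), by the inequality of Young. *)
Lemma expR_sub_le_conj r t L : (0 < r)%R -> (0 <= t)%R ->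
  monotone_conj alpha (m * (Num.sqrt 2 * expR 1 * r)) <= L%:E ->
  (expR_sub (r * t))%:E <= 1 + ((expR L - 1) / 2)%:E * expeR (alpha t).
Proof.
move=> r0 t0; set g := (Num.sqrt 2 * expR 1 * r)%R => gL.
have g0 : (0 < g)%R by rewrite !mulr_gt0// ?sqrtr_gt0 ?expR_gt0.
have m0 : (0 < m)%R by rewrite lt_max !invr_gt0 u0 orbT.
have L0 : (0 < L)%R.
  by rewrite -lte_fin; apply: lt_le_trans gL; apply: (monotone_conj_gt0 A2); rewrite mulr_gt0.
have eL : (0 < expR L - 1)%R by rewrite subr_gt0 expR_gt1.
have [s [sp sumL]] : exists s : nat -> R,
    (forall p, (2 <= p)%N -> (0 < s p)%R /\ monotone_conj alpha (s p) <= p%:R%:E)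
    /\ forall n, (\sum_(2 <= p < n) (g / s p) ^+ p <= expR L - 1)%R.
  have [gu|gu] := leP g (u * psi2)%R.
    exists (fun=> psi2); split; last exact: geometric_moments_le (ltW g0) gu gL.
    by move=> p p2; split=> //; apply: (le_trans conj_psi2); rewrite lee_fin ler_nat.
  have : monotone_conj alpha (g / u) <= L%:E.
    apply: le_trans gL; apply: monotone_conj_homo.
    by rewrite mulrC ler_wpM2r ?(ltW g0)// le_max lexx orbT.
  have := monotone_conj_ge0 Calpha (g / u).
  case E : (monotone_conj alpha (g / u)) => [T| |]// _; rewrite lee_fin => TL.
  by eexists; exact: exponential_moments_le gu E TL.
have := class_C_ge0 Calpha t0; case E : (alpha t) => [x| |]// _; last first.
  by rewrite gt0_muley ?leey// lte_fin divr_gt0.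
rewrite /= -EFinM -EFinD lee_fin /expR_sub lerBlDr.
have ex := expR_gt0 x.
have y0 : (0 <= r * t)%R by rewrite mulr_ge0// ltW.
have B0 : (0 <= (expR L - 1) / 2 * expR x)%R by rewrite !mulr_ge0// ltW.
apply: expR_le_sum_exp_coeff => -[|[|n]].
- by rewrite big_geq//; lra.
- by rewrite big_nat1 expr0 fact0 divr1; lra.
rewrite big_ltn// big_ltn// expr0 expr1 (factS 0) fact0 muln1 !divr1.
suff : (\sum_(2 <= i < n.+2) (r * t) ^+ i / i`!%:R <= (expR L - 1) / 2 * expR x)%R by lra.
apply: (@le_trans _ _ (expR x / 2 * \sum_(2 <= p < n.+2) (g / s p) ^+ p))%R; last first.
  rewrite [leRHS](_ : _ = expR x / 2 * (expR L - 1))%R; last by ring.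
  by rewrite ler_wpM2l// divr_ge0// ltW.
rewrite big_distrr/= big_nat_cond [leRHS]big_nat_cond; apply: ler_sum => p.
rewrite andbT => /andP[p2 _]; have [s0 sple] := sp _ p2.
exact: (moment_le p2 (ltW r0) s0 sple t0 E).
Qed.

End moment_generating_bound.

(** * Relative entropy through a density *)

Lemma nondecreasing_emeasurable {R : realType} (h : R -> \bar R) :
  {homo h : x y / (x <= y)%R >-> x <= y} -> measurable_fun setT h.
Proof.
move=> hh; apply: (measurability _ (ErealGenOInfty.measurableE R)).
move=> /= _ [_ [a ->]] <-; apply: measurableI => //; apply: is_interval_measurable.
move=> x y; rewrite preimage_itvoy /= => ax _ z /andP[xz _].
by apply: lt_le_trans ax _; exact: hh.
Qed.

Section relative_entropy_density.
Context {R : realType} {d : measure_display} {T : measurableType d}.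
Variables nu mu : probability T R.

(** On the set where the density vanishes the logarithm is infinite, but that
    set is null for nu, and x ln x = 0 at x = 0. *)
Lemma relative_entropyE : nu `<< mu ->
  exists f : T -> R, [/\ measurable_fun setT f, (forall x, 0 <= f x)%R,
    (forall A, measurable A -> nu A = \int[mu]_(x in A) (f x)%:E) &
    relative_entropy nu mu = \int[mu]_x (f x * ln (f x))%:E].
Proof.
move=> numu; pose g := Radon_Nikodym_SigmaFinite.f nu mu.
have g0 x : 0 <= g x by exact: Radon_Nikodym_SigmaFinite.f_ge0.
have gfin x : g x \is a fin_num by exact: Radon_Nikodym_SigmaFinite.f_fin_num.
have mg : measurable_fun setT g.
  exact: measurable_int (Radon_Nikodym_SigmaFinite.f_integrable _).
pose f := fine \o g.
have fE x : (f x)%:E = g x by rewrite /f/= fineK.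
have f0 x : (0 <= f x)%R by rewrite -lee_fin fE.
have mf : measurable_fun setT f by exact: measurableT_comp.
have mlne : measurable_fun setT (fun r : R => lne r%:E).
  apply: nondecreasing_emeasurable => x y xy /=.
  case: ifPn => x0; first by rewrite leNye.
  rewrite -ltNge in x0.
  have y0 : (0 < y)%R by exact: lt_le_trans xy.
  by rewrite (lt_geF y0) lee_fin ler_ln.
pose l x := lne (g x).
have ml : measurable_fun setT l.
  have -> : l = (fun r : R => lne r%:E) \o f by apply/funext => x; rewrite /l -fE.
  exact: measurableT_comp.
exists f; split => //.
  move=> A mA; rewrite (Radon_Nikodym_SigmaFinite.f_integral numu)//.
  by apply: eq_integral => x _; rewrite fE.
rewrite /relative_entropy asboolT//.
have gRN : ae_eq nu setT g (Radon_Nikodym (charge_of_finite_measure nu) mu).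
  apply: (null_dominates_ae_eq measurableT numu).
  exact: ae_eq_Radon_Nikodym_SigmaFinite.
transitivity (\int[nu]_x l x).
  apply: ae_eq_integral => //.
    set RN := Radon_Nikodym _ _.
    have -> : (fun x => lne (RN x)) = (fun r : R => lne r%:E) \o (fine \o RN).
      by apply/funext => x; rewrite -[RHS]/(lne (fine (RN x))%:E) fineK// Radon_Nikodym_fin_num.
    apply: measurableT_comp => //; apply: measurableT_comp => //.
    exact: measurable_int (Radon_Nikodym_integrable _).
  exact: ae_eq_sym (ae_eq_comp (@lne R) gRN).
have [lp ln_] : (forall x, l^\+ x * (f x)%:E = (fun x => (f x * ln (f x))%:E)^\+ x) /\
    (forall x, l^\- x * (f x)%:E = (fun x => (f x * ln (f x))%:E)^\- x).
  split=> x; rewrite ?funeposE ?funenegE /l -fE; move: (f0 x).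
    rewrite le_eqVlt => /predU1P[<-|fx]; first by rewrite mule0 mul0r maxxx.
    by rewrite lne_EFin// -EFin_max -EFinM maxr_pMl ?ltW// mul0r EFin_max mulrC.
  rewrite le_eqVlt => /predU1P[<-|fx]; first by rewrite mule0 mul0r oppe0 maxxx.
  by rewrite lne_EFin// -EFinN -EFin_max -EFinM maxr_pMl ?ltW// mul0r EFin_max mulNr mulrC.
rewrite integralE [RHS]integralE; congr (_ - _).
- rewrite -(Radon_Nikodym_SigmaFinite.change_of_variables numu)//; last exact: measurable_funepos.
  by apply: eq_integral => x _; rewrite -/g -fE lp.
- rewrite -(Radon_Nikodym_SigmaFinite.change_of_variables numu)//; last exact: measurable_funeneg.
  by apply: eq_integral => x _; rewrite -/g -fE ln_.
Qed.

End relative_entropy_density.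

(** * Weighted Pinsker inequality *)

Section integral_values.
Context {R : realType} {d : measure_display} {T : measurableType d}.
Variable mu : probability T R.
Implicit Types (f g : T -> R) (v w : R).

Lemma integral_prob_cst (r : \bar R) : \int[mu]_x r = r.
Proof.
transitivity (\int[mu]_x (cst r) x) => //.
by rewrite integral_cst//= probability_setT mule1.
Qed.

(** Bundling integrability with the value lets linear combinations be
    integrated term by term without integrability side conditions. *)
Definition has_integral f v : Prop :=
  mu.-integrable setT (EFin \o f) /\ \int[mu]_x (f x)%:E = v%:E.

Lemma has_integral_cst v : has_integral (cst v) v.
Proof.
split; first exact: finite_measure_integrable_cst.
exact: (integral_prob_cst v%:E).
Qed.

Lemma has_integralD f g v w : has_integral f v -> has_integral g w ->
  has_integral (fun x => f x + g x)%R (v + w)%R.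
Proof.
move=> [fi fv] [gi gw]; split.
  rewrite (_ : _ \o _ = (EFin \o f) \+ (EFin \o g)); first exact: integrableD.
  by apply/funext => x /=; rewrite EFinD.
under eq_integral do rewrite EFinD.
by rewrite integralD// fv gw.
Qed.

Lemma has_integralZ f v k : has_integral f v ->
  has_integral (fun x => k * f x)%R (k * v)%R.
Proof.
move=> [fi fv]; split.
  rewrite (_ : _ \o _ = (fun x => k%:E * (EFin \o f) x)); first exact: integrableZl.
  by apply/funext => x /=; rewrite EFinM.
under eq_integral do rewrite EFinM.
by rewrite integralZl// fv.
Qed.

Lemma integrable_has_integral f : mu.-integrable setT (EFin \o f) ->
  has_integral f (fine (\int[mu]_x (f x)%:E)).
Proof. by move=> fi; split=> //; rewrite fineK//; exact: integrable_fin_num. Qed.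

Lemma le_has_integral f v (g : T -> \bar R) : has_integral f v ->
  mu.-integrable setT g -> (forall x, (f x)%:E <= g x) ->
  v%:E <= \int[mu]_x g x.
Proof. by move=> [fi <-] gi fg; apply: le_integral => // x _; exact: fg. Qed.

Lemma ge0_integrable_fin (g : T -> \bar R) : measurable_fun setT g ->
  (forall x, 0 <= g x) -> \int[mu]_x g x < +oo -> mu.-integrable setT g.
Proof.
move=> mg g0 gi; apply/integrableP; split=> //.
by under eq_integral do rewrite gee0_abs//.
Qed.

Lemma integrable_bounded_below f (k : R) : measurable_fun setT f ->
  (forall x, - k <= f x)%R -> \int[mu]_x (f x)%:E < +oo ->
  mu.-integrable setT (EFin \o f).
Proof.
move=> mf kf; have mEf : measurable_fun setT (EFin \o f) by exact/measurable_EFinP.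
have k0 x : 0 <= (EFin \o f)^\- x <= `|k|%:E.
  rewrite funeneg_ge0 funenegE ge_max /= !lee_fin normr_ge0 andbT.
  by rewrite (le_trans _ (ler_norm k))// lerNl.
have in_ : \int[mu]_x (EFin \o f)^\- x <= `|k|%:E.
  apply: (@le_trans _ _ (\int[mu]_x (cst `|k|%:E) x)).
    apply: ge0_le_integral => //; first exact: measurable_funeneg.
    by move=> x _; have /andP[] := k0 x.
  by rewrite integral_prob_cst.
move=> fi; have {fi} : \int[mu]_x (EFin \o f) x < +oo by [].
rewrite integralE => fi.
have ip : \int[mu]_x (EFin \o f)^\+ x < +oo.
  have : 0 <= \int[mu]_x (EFin \o f)^\- x by exact: integral_ge0.
  move: fi in_; set u := \int[mu]_x (EFin \o f)^\+ x.
  by set v := \int[mu]_x (EFin \o f)^\- x; case: u => [u| |]//; case: v => [v| |]// *; rewrite ltry.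
have pos_int : mu.-integrable setT (EFin \o f)^\+.
  exact: ge0_integrable_fin (measurable_funepos mEf) (fun x => funepos_ge0 _ x) ip.
have neg_int : mu.-integrable setT (EFin \o f)^\-.
  apply: ge0_integrable_fin (measurable_funeneg mEf) (fun x => funeneg_ge0 _ x) _.
  exact: le_lt_trans in_ (ltry _).
by rewrite (funeposneg (EFin \o f)); exact: integrableB.
Qed.

End integral_values.

Section weighted_transport_entropy.
Context {R : realType} {d : measure_display} {T : measurableType d}.
Variables (mu : probability T R) (f chi : T -> R) (W : T -> \bar R) (s L : R).
Hypotheses (mf : measurable_fun setT f) (f0 : forall x, (0 <= f x)%R)
  (f1 : \int[mu]_x (f x)%:E = 1).
Hypotheses (chi0 : forall x, (0 <= chi x)%R)
  (chi_int : mu.-integrable setT (EFin \o chi)).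
Hypotheses (mW : measurable_fun setT W) (W0 : forall x, 0 <= W x)
  (W2 : \int[mu]_x W x <= 2%:E).
Hypotheses (s0 : (0 < s)%R) (L0 : (0 < L)%R).
Hypothesis chiW : forall x,
  (expR_sub (2 * (s * chi x)))%:E <= 1 + ((expR L - 1) / 2)%:E * W x.

Let W_int : mu.-integrable setT W.
Proof. by apply: ge0_integrable_fin => //; exact: le_lt_trans W2 (ltry _). Qed.

Let A : R := fine (\int[mu]_x (chi x)%:E).

Let chiA : has_integral mu chi A.
Proof. exact: integrable_has_integral. Qed.

Let eL : (1 < expR L)%R. Proof. by rewrite expR_gt1. Qed.

(** Jensen's inequality for exp (x) - x, obtained from the tangent at the mean. *)
Lemma expR_sub_mean_le : (expR_sub (2 * (s * A)) <= expR L)%R.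
Proof.
set y := (2 * (s * A))%R; set k := ((expR L - 1) / 2)%R.
have k0 : (0 < k)%R by rewrite divr_gt0// subr_gt0.
have H : has_integral mu (fun x => (expR y - y - (expR y - 1) * y) +
    ((expR y - 1) * (2 * s)) * chi x)%R
    (expR y - y - (expR y - 1) * y + ((expR y - 1) * (2 * s)) * A)%R.
  by apply: has_integralD; [exact: has_integral_cst|exact: has_integralZ].
have : (expR y - y - (expR y - 1) * y + ((expR y - 1) * (2 * s)) * A)%:E
    <= \int[mu]_x (1 + k%:E * W x).
  apply: le_has_integral H _ _.
    apply: integrableD => //; last exact: integrableZl.
    exact: finite_measure_integrable_cst.
  move=> x; apply: le_trans (chiW x); rewrite lee_fin.
  apply: le_trans (expR_sub_tangent (2 * (s * chi x)) y).
  by rewrite le_eqVlt; apply/orP; left; apply/eqP; ring.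
rewrite integralD//; [|exact: finite_measure_integrable_cst|exact: integrableZl].
rewrite integral_prob_cst integralZl// => yW.
rewrite -lee_fin; apply: (@le_trans _ _ (1 + k%:E * 2%:E)).
  apply: (@le_trans _ _ (1 + k%:E * \int[mu]_x W x)).
    apply: le_trans yW; rewrite lee_fin /expR_sub /y.
    by rewrite le_eqVlt; apply/orP; left; apply/eqP; ring.
  by rewrite leeD2l// lee_wpmul2l// lee_fin ltW.
by rewrite -EFinM -EFinD lee_fin /k; lra.
Qed.

Let h x : R := if (1 <= f x)%R then chi x else (- chi x)%R.

Let h_int : mu.-integrable setT (EFin \o h).
Proof.
apply: le_integrable chi_int => //.
- apply/measurable_EFinP; rewrite /h.
  have mchi : measurable_fun setT chi by exact/measurable_EFinP/(measurable_int _ chi_int).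
  apply: measurable_fun_ifT => //; last exact: measurableT_comp.
  exact: measurable_fun_ler.
- move=> x _ /=; rewrite lee_fin /h; case: ifP => // _.
  by rewrite normrN.
Qed.

Let b : R := fine (\int[mu]_x (h x)%:E).

Let h_mean : has_integral mu h b.
Proof. exact: integrable_has_integral. Qed.

Let b_le : (`|b| <= A)%R.
Proof.
have [_ bE] := h_mean; have [_ AE] := chiA.
rewrite -lee_fin -AE -abse_EFin -bE.
apply: le_trans (le_abse_integral _ _ _) _ => //.
  exact: measurable_int h_int.
apply: ge0_le_integral => //.
- apply: measurableT_comp => //; exact: measurable_int h_int.
- exact: measurable_int chi_int.
- move=> x _; rewrite /= lee_fin /h; case: ifP => _; rewrite ?normrN ger0_norm//.
Qed.

(** Young's inequality for the relative entropy is applied to the centred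
    function s (h - b), where h = chi on the set f >= 1 and h = - chi elsewhere,
    so that h (f - 1) = chi |f - 1|.  Centring costs nothing because the
    integral of f - 1 vanishes. *)
Lemma weighted_transport_entropy :
  s%:E * \int[mu]_x (chi x * `|f x - 1|)%:E <= \int[mu]_x (f x * ln (f x))%:E + L%:E.
Proof.
have [->|Hy] := eqVneq (\int[mu]_x (f x * ln (f x))%:E) +oo; first by rewrite leey.
have mfln : measurable_fun setT (fun x => f x * ln (f x))%R.
  by apply: measurable_funM => //; exact: measurableT_comp.
have fln_int : mu.-integrable setT (EFin \o (fun x => f x * ln (f x))%R).
  apply: (@integrable_bounded_below _ _ _ _ _ 1%R) => //; last by rewrite ltey.
  move=> x; have := entropy_young 0 0 (f0 x).
  rewrite subr0 expR0 mul0r; have := f0 x; lra.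
have := integrable_has_integral fln_int; set H := fine _ => flnH.
have fI : has_integral mu f 1%R.
  split=> //; apply: ge0_integrable_fin; [exact/measurable_EFinP| |].
    by move=> x; rewrite /= lee_fin.
  by rewrite /= f1 ltry.
set F := expR_sub (2 * (s * A)).
have FL : (F <= expR L)%R by exact: expR_sub_mean_le.
pose k3 := ((expR L - 1) / (4 * expR L))%R.
have k30 : (0 < k3)%R by rewrite divr_gt0 ?subr_gt0// mulr_gt0// expR_gt0.
pose c0 := (expR (- L) * (- s * b + 2^-1 + F / 2))%R.
pose c1 := (s * b - 1 + L)%R.
pose c2 := (expR (- L) * s - s)%R.
(* the bound by Young's inequality, with its terms collected by integrand *)
pose g x := (c0 + (c1 * f x + (c2 * h x + f x * ln (f x))))%R.
have gI : has_integral mu g (c0 + (c1 * 1 + (c2 * b + H)))%R.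
  apply: has_integralD; first exact: has_integral_cst.
  apply: has_integralD; first exact: has_integralZ.
  by apply: has_integralD => //; exact: has_integralZ.
have mchi : measurable_fun setT chi by exact/measurable_EFinP/(measurable_int _ chi_int).
have mlhs : measurable_fun setT (fun x => (chi x * `|f x - 1|)%:E).
  apply/measurable_EFinP; apply: measurable_funM => //.
  by apply: measurableT_comp => //; exact: measurable_funB.
rewrite -ge0_integralZl//; last 2 first.
- by move=> x _; rewrite lee_fin mulr_ge0.
- by rewrite lee_fin ltW.
have kW_int : mu.-integrable setT (fun x => k3%:E * W x) by exact: integrableZl.
have G_int : mu.-integrable setT (fun x => (g x)%:E + k3%:E * W x).
  by apply: integrableD => //; case: gI.
have bound x : s%:E * (chi x * `|f x - 1|)%:E <= (g x)%:E + k3%:E * W x.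
  have := chiW x; have := W0 x; case: (W x) => [w| |]// w0; last first.
    by move=> _; rewrite gt0_muley ?lte_fin// addey// leey.
  rewrite -!EFinM -!EFinD !lee_fin => Fw.
  set y := (s * h x - s * b)%R.
  have hx : (chi x * `|f x - 1| = h x * (f x - 1))%R.
    rewrite /h; case: leP => fx; first by rewrite ger0_norm ?subr_ge0.
    by rewrite ltr0_norm ?subr_lt0//; ring.
  have hn : (`|s * h x| <= s * chi x)%R.
    rewrite normrM (gtr0_norm s0) ler_pM2l//.
    by rewrite /h; case: ifP => _; rewrite ?normrN ger0_norm.
  have bn : (`|s * b| <= s * A)%R by rewrite normrM (gtr0_norm s0) ler_pM2l.
  have ey := expR_centered_le hn bn; rewrite -/F -/y in ey.
  have yf := entropy_young y L (f0 x).
  rewrite expRD in yf; have e0 := expR_gt0 (- L).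
  have ek : (expR (- L) * expR L = 1)%R by rewrite mulrC expRxMexpNx_1.
  have -> : k3 = (expR (- L) * (expR L - 1) / 4)%R.
    by rewrite /k3 expRN; field; rewrite gt_eqF// expR_gt0.
  have : (expR y * expR (- L) <= expR (- L) * (y + ((1 + (expR L - 1) / 2 * w) + F) / 2))%R.
    rewrite mulrC ler_wpM2l ?(ltW e0)//; lra.
  rewrite hx /g /c0 /c1 /c2; move: (expR (- L)) e0 ek yf => e e0 ek yf.
  have -> : (s * (h x * (f x - 1)) = y * f x - y + s * b * (f x - 1))%R by rewrite /y; ring.
  have -> : ((e * s - s) * h x = (e - 1) * (y + s * b))%R by rewrite /y; ring.
  lra.
apply: le_trans (le_integral _ _ G_int (fun x _ => bound x)) _ => //.
  apply: le_integrable G_int => //.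
    exact: measurable_funeM.
  move=> x _; rewrite gee0_abs; last first.
    by rewrite mule_ge0 ?lee_fin ?(ltW s0)// mulr_ge0.
  by apply: le_trans (bound x) _; exact: lee_abs.
rewrite integralD//; last by case: gI.
have [_ ->] := gI; have [_ ->] := flnH.
rewrite integralZl//.
apply: (@le_trans _ _ ((c0 + (c1 * 1 + (c2 * b + H)))%:E + k3%:E * 2%:E)).
  by rewrite leeD2l// lee_wpmul2l// lee_fin ltW.
rewrite -EFinM -!EFinD lee_fin.
have e0 := expR_gt0 (- L).
have ek : (expR (- L) * expR L = 1)%R by rewrite mulrC expRxMexpNx_1.
have -> : k3 = (expR (- L) * (expR L - 1) / 4)%R.
  by rewrite /k3 expRN; field; rewrite gt_eqF// expR_gt0.
rewrite /c0 /c1 /c2.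
have : (expR (- L) * F <= 1)%R by rewrite -ek ler_wpM2l// ltW.
move: (expR (- L)) (expR L) ek => e e' ek eF.
have -> : (e * (e' - 1) / 4 * 2 = (e * e' - e) / 2)%R by field.
rewrite ek.
lra.
Qed.

End weighted_transport_entropy.

(** * Coupling along the common part *)

Section density_measure.
Context {R : realType} {d : measure_display} {T : measurableType d}.
Variables (mu : {finite_measure set T -> \bar R}) (g : T -> R).
Hypotheses (mg : measurable_fun setT g) (g0 : forall x, (0 <= g x)%R)
  (gi : \int[mu]_x (g x)%:E < +oo).

(** The proofs are arguments so that the measure structure can be inferred. *)
Definition density_measure of measurable_fun setT g & (forall x, (0 <= g x)%R)
    & \int[mu]_x (g x)%:E < +oo :=
  fun A : set T => \int[mu]_(x in A) (g x)%:E.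

Local Notation nu := (density_measure mg g0 gi).

Let nu0 : nu set0 = 0.
Proof. by rewrite /density_measure integral_set0. Qed.

Let nu_ge0 A : 0 <= nu A.
Proof. by apply: integral_ge0 => x _; rewrite lee_fin. Qed.

Let mEg : measurable_fun setT (EFin \o g).
Proof. exact/measurable_EFinP. Qed.

Let nu_sigma_additive : semi_sigma_additive nu.
Proof.
move=> F mF tF mUF; rewrite /density_measure ge0_integral_bigcup//.
- by apply: is_cvg_ereal_nneg_natsum_cond => n _ _; exact: nu_ge0.
- exact: measurable_funS mEg.
- by move=> x _; rewrite lee_fin.
Qed.

HB.instance Definition _ := isMeasure.Build _ _ _ nu nu0 nu_ge0 nu_sigma_additive.

Let nu_finite : fin_num_fun nu.
Proof.
move=> A mA; rewrite ge0_fin_numE//; apply: le_lt_trans gi.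
by apply: ge0_subset_integral => // x _; rewrite lee_fin.
Qed.

HB.instance Definition _ := @Measure_isFinite.Build _ _ _ nu nu_finite.

Lemma ge0_integral_density (h : T -> \bar R) : measurable_fun setT h ->
  (forall x, 0 <= h x) ->
  \int[nu]_x h x = \int[mu]_x (h x * (g x)%:E).
Proof.
move=> mh h0.
have numu : nu `<< mu.
  apply/null_content_dominatesP => A mA muA.
  by rewrite /= /density_measure null_set_integral//; exact/measurable_funTS.
rewrite -(Radon_Nikodym_SigmaFinite.change_of_variables numu)//.
apply: ae_eq_integral => //.
- apply: emeasurable_funM => //.
  exact: measurable_int (Radon_Nikodym_SigmaFinite.f_integrable _).
- exact: emeasurable_funM.
apply: ae_eqe_mul2l; apply: integral_ae_eq => //.
- exact: Radon_Nikodym_SigmaFinite.f_integrable.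
- by move=> A _ mA; rewrite -(Radon_Nikodym_SigmaFinite.f_integral numu).
Qed.

End density_measure.

Lemma probability_of_measure {R : realType} {d} {T : measurableType d}
    (m : {measure set T -> \bar R}) : m setT = 1 ->
  exists P : probability T R, forall A, P A = m A.
Proof.
move=> /= m1; exists (mnormalize m (\d_(point : T))) => A.
rewrite -[LHS]/(mnormalize m (\d_(point : T)) A) /mnormalize.
have -> : m [set: T] = 1 by exact: m1.
by rewrite onee_eq0/= invr1 mule1.
Qed.

Section overlap_coupling.
Context {R : realType} {d : measure_display} {T : measurableType d}.
Variables (nu mu : probability T R) (f : T -> R).
Hypotheses (mf : measurable_fun setT f) (f0 : forall x, (0 <= f x)%R)
  (fE : forall A, measurable A -> nu A = \int[mu]_(x in A) (f x)%:E).

Let w x : R := Num.min (f x) 1%R.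
Let p x : R := Num.max (f x - 1)%R 0%R.
Let n x : R := Num.max (1 - f x)%R 0%R.

Let fwp x : f x = (w x + p x)%R.
Proof. by rewrite /w /p minEle maxEle; case: (leP (f x) 1%R) => ?; case: leP => ?; lra. Qed.

Let wn x : 1%R = (w x + n x)%R.
Proof. by rewrite /w /n minEle maxEle; case: (leP (f x) 1%R) => ?; case: leP => ?; lra. Qed.

Let pn x : `|f x - 1|%R = (p x + n x)%R.
Proof.
rewrite /p /n; case: (leP 1%R (f x)) => fx.
  by rewrite ger0_norm ?subr_ge0// max_l ?subr_ge0// max_r ?subr_le0// addr0.
by rewrite ltr0_norm ?subr_lt0// max_r ?subr_le0 ?ltW// max_l ?subr_ge0 ?ltW// add0r opprB.
Qed.

Let w0 x : (0 <= w x)%R. Proof. by rewrite le_min f0 ler01. Qed.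
Let p0 x : (0 <= p x)%R. Proof. by rewrite le_max lexx orbT. Qed.
Let n0 x : (0 <= n x)%R. Proof. by rewrite le_max lexx orbT. Qed.

Let mw : measurable_fun setT w.
Proof. exact: measurable_minr. Qed.
Let mp : measurable_fun setT p.
Proof. by apply: measurable_maxr => //; exact: measurable_funB. Qed.
Let mn : measurable_fun setT n.
Proof. by apply: measurable_maxr => //; exact: measurable_funB. Qed.

Let f1 : \int[mu]_x (f x)%:E = 1.
Proof. by rewrite -fE//= probability_setT. Qed.

Let le_int (g h : T -> R) : measurable_fun setT g -> measurable_fun setT h ->
  (forall x, 0 <= g x)%R -> (forall x, g x <= h x)%R ->
  \int[mu]_x (g x)%:E <= \int[mu]_x (h x)%:E.
Proof.
move=> mg mh g0 gh; apply: ge0_le_integral => //.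
- by move=> x _; rewrite lee_fin.
- exact/measurable_EFinP.
- exact/measurable_EFinP.
- by move=> x _; rewrite lee_fin.
Qed.

Let pi_ : \int[mu]_x (p x)%:E < +oo.
Proof.
apply: (@le_lt_trans _ _ 1); last by rewrite ltry.
by rewrite -f1; apply: le_int => // x; rewrite [leRHS]fwp lerDr.
Qed.

Let wi : \int[mu]_x (w x)%:E < +oo.
Proof.
apply: (@le_lt_trans _ _ 1); last by rewrite ltry.
by rewrite -f1; apply: le_int => // x; rewrite [leRHS]fwp lerDl.
Qed.

Let ni : \int[mu]_x (n x)%:E < +oo.
Proof.
apply: (@le_lt_trans _ _ (\int[mu]_x (cst 1%R x)%:E)).
  by apply: le_int => // x; rewrite /= [leRHS](wn x) lerDr.
by rewrite (integral_prob_cst mu 1) ltry.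
Qed.

Let Wm := density_measure mw w0 wi.
Let Pm := density_measure mp p0 pi_.
Let Nm := density_measure mn n0 ni.

Let WP A : measurable A -> Wm A + Pm A = nu A.
Proof.
move=> mA; rewrite fE// -ge0_integralD//; last 4 first.
- by move=> x _; rewrite lee_fin.
- by apply/measurable_EFinP; exact: measurable_funTS.
- by move=> x _; rewrite lee_fin.
- by apply/measurable_EFinP; exact: measurable_funTS.
by apply: eq_integral => x _; rewrite [in RHS]fwp EFinD.
Qed.

Let WN A : measurable A -> Wm A + Nm A = mu A.
Proof.
move=> mA; rewrite -ge0_integralD//; last 4 first.
- by move=> x _; rewrite lee_fin.
- by apply/measurable_EFinP; exact: measurable_funTS.
- by move=> x _; rewrite lee_fin.
- by apply/measurable_EFinP; exact: measurable_funTS.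
transitivity (\int[mu]_(x in A) (cst 1) x); last by rewrite integral_cst//= mul1e.
by apply: eq_integral => x _; rewrite /= -EFinD -wn.
Qed.

Let th := fine (Pm setT).

Let PT : Pm setT = th%:E.
Proof. by rewrite /th fineK// fin_num_measure. Qed.

Let NT : Nm setT = th%:E.
Proof.
have := WP measurableT; rewrite -PT probability_setT -(probability_setT mu) -(WN measurableT).
have : Wm setT \is a fin_num by exact: fin_num_measure.
have : Nm setT \is a fin_num by exact: fin_num_measure.
have : Pm setT \is a fin_num by exact: fin_num_measure.
case: (Wm setT) => // a; case: (Pm setT) => // b; case: (Nm setT) => // c _ _ _.
by rewrite -!EFinD => -[] /addrI ->.
Qed.

Let th0 : (0 <= th)%R.
Proof. by rewrite -lee_fin -PT. Qed.

Let thV0 : (0 <= th^-1)%R. Proof. by rewrite invr_ge0. Qed.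

Let diag (x : T) : T * T := (x, x).

Let mdiag : measurable_fun setT diag.
Proof. exact: measurable_fun_pair. Qed.

Let prodm : {measure set (T * T) -> \bar R} := (Pm \x Nm)%E.
Let diagm : {measure set (T * T) -> \bar R}.
Proof. by refine (pushforward Wm diag : {measure set _ -> \bar R}); exact: mdiag. Defined.
Let m0 : {measure set (T * T) -> \bar R} :=
  measure_add diagm (mscale (NngNum thV0) prodm).

Let m0E A : m0 A = Wm (diag @^-1` A) + th^-1%:E * prodm A.
Proof. exact: measure_addE. Qed.

(* When th = 0 both remainders vanish, so dividing by th is harmless. *)
Let scale_th (B : set T) (M : {finite_measure set T -> \bar R}) : measurable B ->
  M setT = th%:E -> th^-1%:E * (M B * th%:E) = M B.
Proof.
move=> mB MT; have Mfin : M B \is a fin_num by exact: fin_num_measure.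
have [th_eq0|th_neq0] := eqVneq th 0%R.
  suff -> : M B = 0 by rewrite mul0e mule0.
  apply/eqP; rewrite eq_le measure_ge0 andbT.
  by rewrite -[leRHS]/(0%R%:E) -th_eq0 -MT le_measure// inE.
by rewrite -(fineK Mfin) -!EFinM; congr (_%:E); field.
Qed.

(** The mass min(f, 1) mu shared by nu and mu stays put, at no cost; the rest,
    (f - 1)^+ mu, is sent to (1 - f)^+ mu by an independent coupling. *)
Lemma transport_cost_le_weighted_variation (c : T -> T -> R) (chi : T -> R) (k : R) :
  cost_function c -> measurable_fun setT (fun z : T * T => c z.1 z.2) ->
  measurable_fun setT chi -> (forall x, 0 <= chi x)%R -> (0 <= k)%R ->
  (forall x y, c x y <= k * (chi x + chi y))%R ->
  transport_cost c nu mu <= k%:E * \int[mu]_x (chi x * `|f x - 1|)%:E.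
Proof.
move=> [c0 cxx] mc mchi chi0 k0 ck.
have marg1 A : measurable A -> m0 (fst @^-1` A) = nu A.
  move=> mA; rewrite m0E -WP//; congr (_ + _).
  have -> : fst @^-1` A = A `*` [set: T] by apply/seteqP; split=> z /=; tauto.
  rewrite /prodm/= product_measure1E//.
  rewrite -[X in _ * (_ * X)]/(Nm setT) NT; exact: (scale_th mA PT).
have marg2 A : measurable A -> m0 (snd @^-1` A) = mu A.
  move=> mA; rewrite m0E -WN//; congr (_ + _).
  have -> : snd @^-1` A = [set: T] `*` A by apply/seteqP; split=> z /=; tauto.
  rewrite /prodm/= product_measure1E// muleC.
  rewrite -[X in (X * _) * _]/(Pm setT) PT (muleC th%:E) muleC.
  exact: (scale_th mA NT).
have [P PE] : exists P : probability (T * T)%type R, forall A, P A = m0 A.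
  apply: probability_of_measure; rewrite -[RHS](probability_setT nu) -(marg1 _ measurableT).
  by rewrite preimage_setT.
have Pc : coupling nu mu P by move=> A mA; rewrite !PE marg1// marg2.
apply: (@le_trans _ _ (\int[P]_z (c z.1 z.2)%:E)).
  by apply: ereal_inf_lbound; exists P.
have mEc : measurable_fun setT (fun z : T * T => (c z.1 z.2)%:E) by exact/measurable_EFinP.
have Ec0 (z : T * T) : 0 <= (c z.1 z.2)%:E by rewrite lee_fin.
rewrite (eq_measure_integral m0); last by move=> A mA _; exact: PE.
rewrite ge0_integral_measure_add// ge0_integral_pushforward//.
rewrite integral0_eq; last by move=> x _ /=; rewrite cxx.
rewrite add0e ge0_integral_mscale//.
have mchi1 : measurable_fun setT (fun z : T * T => (chi z.1)%:E).
  by apply/measurable_EFinP; exact: measurableT_comp.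
have mchi2 : measurable_fun setT (fun z : T * T => (chi z.2)%:E).
  by apply/measurable_EFinP; exact: measurableT_comp.
have mEchi : measurable_fun setT (EFin \o chi) by exact/measurable_EFinP.
have int_chi (g : T -> R) : measurable_fun setT g -> (forall x, 0 <= g x)%R ->
    0 <= \int[mu]_x (chi x * g x)%:E.
  by move=> _ g0; apply: integral_ge0 => x _; rewrite lee_fin mulr_ge0.
have prod_le : \int[prodm]_z (c z.1 z.2)%:E <=
    k%:E * (th%:E * \int[mu]_x (chi x * `|f x - 1|)%:E).
  apply: (@le_trans _ _ (\int[prodm]_z (k%:E * ((chi z.1)%:E + (chi z.2)%:E)))).
    apply: ge0_le_integral => //.
      by apply: measurable_funeM; exact: emeasurable_funD.
    by move=> z _; rewrite -EFinD -EFinM lee_fin.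
  have msum : measurable_fun setT (fun z : T * T => (chi z.1)%:E + (chi z.2)%:E).
    exact: emeasurable_funD.
  have sum0 (z : T * T) : setT z -> 0 <= (chi z.1)%:E + (chi z.2)%:E.
    by move=> _; rewrite adde_ge0 ?lee_fin.
  have kE0 : 0 <= k%:E by rewrite lee_fin.
  rewrite (ge0_integralZl prodm measurableT msum sum0 kE0).
  rewrite lee_wpmul2l ?lee_fin//.
  rewrite ge0_integralD//; last 2 first.
  - by move=> z _; rewrite lee_fin.
  - by move=> z _; rewrite lee_fin.
  rewrite /prodm/= !fubini_tonelli1//; last 2 first.
  - by move=> z; rewrite lee_fin.
  - by move=> z; rewrite lee_fin.
  rewrite /fubini_F/=.
  have cstN (r : \bar R) : \int[Nm]_y r = th%:E * r.
    by rewrite -NT muleC; exact: (integral_cst Nm measurableT r).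
  have cstP (r : \bar R) : \int[Pm]_y r = th%:E * r.
    by rewrite -PT muleC; exact: (integral_cst Pm measurableT r).
  have Echi0 (x : T) : 0 <= (chi x)%:E by rewrite lee_fin.
  have th0E : 0 <= th%:E by rewrite lee_fin.
  have -> : \int[Pm]_x \int[Nm]_y (chi x)%:E = th%:E * \int[mu]_x (chi x * p x)%:E.
    transitivity (\int[Pm]_x (th%:E * (chi x)%:E)).
      by apply: eq_integral => x _; exact: cstN.
    rewrite (ge0_integralZl Pm measurableT mEchi (fun x _ => Echi0 x) th0E).
    by rewrite (ge0_integral_density mp p0 pi_ mEchi Echi0).
  have -> : \int[Pm]_x \int[Nm]_y (chi y)%:E = th%:E * \int[mu]_x (chi x * n x)%:E.
    rewrite cstP.
    by rewrite (ge0_integral_density mn n0 ni mEchi Echi0).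
  rewrite -ge0_muleDr; last 2 first.
  - exact: int_chi.
  - exact: int_chi.
  rewrite lee_wpmul2l ?lee_fin//.
  rewrite -ge0_integralD//; last 4 first.
  - by move=> x _; rewrite lee_fin mulr_ge0.
  - by apply/measurable_EFinP; exact: measurable_funM.
  - by move=> x _; rewrite lee_fin mulr_ge0.
  - by apply/measurable_EFinP; exact: measurable_funM.
  under eq_integral do rewrite -EFinD -mulrDr -pn.
  by [].
apply: le_trans (lee_wpmul2l _ prod_le) _; first by rewrite lee_fin.
rewrite muleCA lee_wpmul2l ?lee_fin// muleA -EFinM /=.
have [->|th_neq0] := eqVneq th 0%R.
  rewrite mulr0 mul0e; apply: int_chi => //; apply: measurableT_comp => //.
  exact: measurable_funB.
by rewrite mulVf// mul1e.
Qed.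

End overlap_coupling.

(** * Costs on a separable metric space *)

Section metric_cost.
Context {R : realType} (X : completeMetricType R).
Implicit Types (x y : X).

Lemma ball_is_open x (r : R) : open (ball x r).
Proof.
rewrite openE => y; rewrite ballEmdist/= => xyr.
apply/nbhs_ballP; exists (r - mdist x y)%R; first by rewrite /= subr_gt0.
move=> z; rewrite ballEmdist/= => yz.
by apply: le_lt_trans (metric_triangle x y z) _; rewrite -ltrBrDl.
Qed.

Lemma measurable_mdist_from x : measurable_fun setT (fun y : borel X => mdist x y).
Proof.
apply: (measurability _ (RGenInftyO.measurableE R)) => /= _ [_ [r ->]] <-.
apply: measurableI => //; apply: sub_sigma_algebra.
have -> : (fun y : borel X => mdist x y) @^-1` `]-oo, r[ = ball x r.
  by rewrite ballEmdist; apply/seteqP; split => y /=; rewrite in_itv.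
exact: ball_is_open.
Qed.

(** Separability makes the distance measurable for the product of the Borel
    sigma-algebras: d(x, y) < r holds iff d(k, x) + d(k, y) < r for some k in a
    countable dense set. *)
Lemma measurable_mdist : separable X ->
  measurable_fun setT (fun z : borel X * borel X => mdist (z.1 : X) z.2).
Proof.
move=> [D cD dD].
apply: (measurability _ (RGenInftyO.measurableE R)) => /= _ [_ [r ->]] <-.
apply: measurableI => //.
pose S k := [set z : borel X * borel X | (mdist (k : X) z.1 + mdist (k : X) z.2 < r)%R].
have -> : (fun z : borel X * borel X => mdist (z.1 : X) z.2) @^-1` `]-oo, r[
    = \bigcup_(k in D) S k.
  apply/seteqP; split => [[x y]|[x y] [k Dk]] /=; rewrite in_itv/=.
    move=> xyr; have e0 : (0 < (r - mdist (x : X) y) / 2)%R by rewrite divr_gt0 ?subr_gt0.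
    have [k [xk Dk]] : ball (x : X) ((r - mdist (x : X) y) / 2) `&` D !=set0.
      apply: dD; last exact: ball_is_open.
      by exists x; exact: ballxx.
    exists k => //=; move: xk; rewrite ballEmdist/= => xk.
    have := metric_triangle (k : X) x y; rewrite [mdist k x]metric_sym => kxy.
    rewrite /S /= [mdist k x]metric_sym; lra.
  rewrite /S /= => kxy; apply: le_lt_trans kxy.
  by rewrite [mdist k x]metric_sym; exact: metric_triangle.
have [->|/set0P[r0 Dr0]] := eqVneq D set0; first by rewrite bigcup_set0.
have /countable_injP[j injj] := cD.
rewrite -(injpinv_image (cst r0) injj) bigcup_image.
apply: bigcup_measurable => i _; move: ('pinv_(cst r0) D j i) => k.
have mS : measurable_fun setT (fun z : borel X * borel X =>
    (mdist (k : X) z.1 + mdist (k : X) z.2)%R).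
  by apply: measurable_funD; apply: measurableT_comp => //; exact: measurable_mdist_from.
by have := mS measurableT _ (measurable_itv `]-oo, r[); rewrite setTI; congr measurable;
  apply/seteqP; split => z /=; rewrite in_itv.
Qed.

Variables (q : R -> R) (c : borel X -> borel X -> R) (K : R).
Hypothesis cE : forall x y, c x y = q (mdist x y).
Hypothesis q_incr : forall s t : R, (0 <= s)%R -> (s <= t)%R -> (q s <= q t)%R.
Hypothesis q_convex : convex_function [set t : R | (0 <= t)%R] q.
Hypothesis q_Delta2 : forall t : R, (0 <= t)%R -> (q (2 * t) <= K * q t)%R.

Lemma metric_cost_sym x y : c x y = c y x.
Proof. by rewrite !cE metric_sym. Qed.

(** Apply q to the midpoint of 2 d(x, y) and 2 d(y, z). *)
Lemma metric_cost_triangle x y z : (c x z <= K / 2 * (c x y + c y z))%R.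
Proof.
rewrite !cE.
have d0 (s t : X) : (0 <= mdist s t)%R by exact: mdist_ge0.
apply: (le_trans (q_incr (d0 _ _) (metric_triangle x y z))).
have h0 : (0 <= 2^-1 :> R)%R by lra.
have h1 : (2^-1 <= 1 :> R)%R by lra.
have d20 (s t : X) : (0 <= 2 * mdist s t)%R by rewrite mulr_ge0.
have : (q (2^-1 * (2 * mdist x y) + (1 - 2^-1) * (2 * mdist y z)) <=
    2^-1 * q (2 * mdist x y) + (1 - 2^-1) * q (2 * mdist y z))%R.
  exact: (q_convex (Itv01 h0 h1) (mem_set (d20 x y)) (mem_set (d20 y z))).
have -> : (2^-1 * (2 * mdist x y) + (1 - 2^-1) * (2 * mdist y z) =
    mdist x y + mdist y z)%R by field.
have := q_Delta2 (d0 x y); have := q_Delta2 (d0 y z); lra.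
Qed.

Let measurable_q : measurable_fun setT (fun t : R => q (Num.max t 0%R)).
Proof.
apply/measurable_EFinP; apply: nondecreasing_emeasurable => s t st.
rewrite lee_fin; apply: q_incr; first by rewrite le_max lexx orbT.
by rewrite ge_max !le_max st lexx !orbT.
Qed.

Lemma measurable_metric_cost : separable X ->
  measurable_fun setT (fun z : borel X * borel X => c z.1 z.2).
Proof.
move=> sepX.
have -> : (fun z : borel X * borel X => c z.1 z.2) =
    (fun t : R => q (Num.max t 0%R)) \o (fun z : borel X * borel X => mdist (z.1 : X) z.2).
  by apply/funext => z /=; rewrite cE max_l// mdist_ge0.
apply: measurableT_comp; last exact: measurable_mdist.
exact: measurable_q.
Qed.

Lemma measurable_metric_cost_from x : measurable_fun setT (c x).
Proof.
have -> : c x = (fun t : R => q (Num.max t 0%R)) \o (fun y : borel X => mdist x y).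
  by apply/funext => z /=; rewrite cE max_l// mdist_ge0.
apply: measurableT_comp; last exact: measurable_mdist_from.
exact: measurable_q.
Qed.

End metric_cost.

(** * Transport inequalities in dual form *)

Section relative_entropy_ge0.
Context {R : realType} {d : measure_display} {T : measurableType d}.
Variables nu mu : probability T R.

(** Integrate x ln x >= x - 1. *)
Lemma relative_entropy_ge0 : 0 <= relative_entropy nu mu.
Proof.
have [numu|numu] := pselect (nu `<< mu); last first.
  by rewrite /relative_entropy; case: asboolP => // _; rewrite leey.
have [f [mf f0 fE ->]] := relative_entropyE numu.
have [->|Hy] := eqVneq (\int[mu]_x (f x * ln (f x))%:E) +oo; first by rewrite leey.
have mfln : measurable_fun setT (fun x => f x * ln (f x))%R.
  by apply: measurable_funM => //; exact: measurableT_comp.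
have flnE x : (- 1 + f x <= f x * ln (f x))%R.
  by have := entropy_young 0 0 (f0 x); rewrite subr0 expR0 mul0r; have := f0 x; lra.
have fI : has_integral mu (fun x => - 1 + f x)%R (- 1 + 1)%R.
  apply: has_integralD; first exact: has_integral_cst.
  have f1 : \int[mu]_x (f x)%:E = 1 by rewrite -fE//= probability_setT.
  split=> //; apply: ge0_integrable_fin; [exact/measurable_EFinP| |].
    by move=> x; rewrite /= lee_fin.
  by rewrite /= f1 ltry.
rewrite -[leLHS]/(0%R%:E) -(addNr 1%R); apply: (le_has_integral fI).
  apply: (@integrable_bounded_below _ _ _ _ _ 1%R) => //; last by rewrite ltey.
  by move=> x; have := flnE x; have := f0 x; lra.
by move=> x; rewrite lee_fin.
Qed.

End relative_entropy_ge0.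

Section dual_transport_inequality.
Context {R : realType}.
Variable alpha : R -> \bar R.
Hypothesis Calpha : class_C alpha.
Hypothesis phi_fin : exists2 s : R, (0 < s)%R &
  exists2 L : R, (0 <= L)%R & monotone_conj alpha s = L%:E.
Hypothesis phi_gt0 : forall s : R, (0 < s)%R -> 0 < monotone_conj alpha s.

(** The inequality alpha (t / a) <= h, rewritten with the conjugate of alpha: it
    is linear in a, hence passes to infima of admissible constants a, and still
    makes sense for a = 0. *)
Definition dual_transport_inequality (a : R) (t h : \bar R) : Prop :=
  forall s L : R, (0 < s)%R -> monotone_conj alpha s = L%:E ->
    s%:E * t <= a%:E * (h + L%:E).

Lemma dual_transport_inequality_inf (C : R) (S : set (\bar R)) (r : R)
    (t : \bar R) (h : R) :
  (0 < C)%R -> 0 <= t -> (0 <= h)%R -> ereal_inf S = r%:E ->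
  (forall v : R, S v%:E -> dual_transport_inequality (C * v) t h%:E) ->
  S `<=` [set v | 0 <= v] ->
  dual_transport_inequality (C * r) t h%:E.
Proof.
move=> C0 t0 h0 Sr HS S0 s L s0 sL.
have L0 : (0 < L)%R by have := phi_gt0 s0; rewrite sL.
have [v Sv] : exists v : R, S v%:E.
  apply: contrapT => nS; have : ereal_inf S = +oo; last by rewrite Sr.
  apply/eqP; rewrite -leye_eq; apply: le_ereal_inf_tmp => -[w Sw|//|/S0//].
  by exfalso; apply: nS; exists w.
have := HS v Sv s L s0 sL; rewrite -EFinD -EFinM.
case: t t0 HS => [t| |]// t0 HS; last by rewrite gt0_muley ?lte_fin// leye_eq.
rewrite -!EFinM lee_fin => _; rewrite lee_fin.
have hL : (0 < h + L)%R by lra.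
have ChL : (0 < C * (h + L))%R by rewrite mulr_gt0.
rewrite mulrAC -ler_pdivrMl// -lee_fin -Sr.
apply: le_ereal_inf_tmp => -[w Sw|_|/S0//]; last by rewrite leey.
have := HS w Sw s L s0 sL; rewrite -EFinD -!EFinM !lee_fin ler_pdivrMl//.
by rewrite mulrAC.
Qed.

(** The conjugate is finite at some s > 0, and one such s bounds t. *)
Lemma dual_transport_inequality_fin (a h : R) (t : \bar R) :
  0 <= t -> dual_transport_inequality a t h%:E -> t \is a fin_num.
Proof.
move=> t0 H; have [s s0 [L L0 sL]] := phi_fin.
have := H s L s0 sL; rewrite -EFinD -EFinM.
by case: t t0 {H} => [t| |]//; rewrite gt0_muley ?lte_fin// leye_eq.
Qed.

Lemma dual_transport_inequality0 (h t : R) : (0 <= t)%R ->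
  dual_transport_inequality 0 t%:E h%:E -> t = 0%R.
Proof.
move=> t0 H; have [s s0 [L L0 sL]] := phi_fin.
have := H s L s0 sL; rewrite mul0e -EFinM lee_fin pmulr_rle0// => t0'.
by apply/eqP; rewrite eq_le t0'.
Qed.

Lemma dual_transport_inequality_le (a h t : R) : (0 < a)%R -> (0 <= h)%R -> (0 <= t)%R ->
  dual_transport_inequality a t%:E h%:E -> alpha (t / a)%R <= h%:E.
Proof.
move=> a0 h0 t0 H; apply: (monotone_biconj_le Calpha).
  by rewrite divr_ge0// ltW.
move=> s L; rewrite le_eqVlt => /predU1P[<-|s0] sL.
  have := le_trans (monotone_conj_ge0 Calpha 0%R) sL.
  by rewrite lee_fin mul0r => L0; rewrite addr_ge0.
have := monotone_conj_ge0 Calpha s.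
case E : (monotone_conj alpha s) sL => [l| |]//; rewrite lee_fin => lL _.
have := H s l s0 E; rewrite -EFinD -!EFinM lee_fin => H'.
rewrite mulrA ler_pdivrMr//; apply: le_trans H' _.
by rewrite mulrC ler_wpM2r ?(ltW a0)// lerD2l.
Qed.

Lemma at_ereal_dual_transport (a : R) (t h : \bar R) :
  (0 <= a)%R -> 0 <= t -> 0 <= h ->
  (h != +oo -> dual_transport_inequality a t h) ->
  at_ereal alpha (t / a%:E) <= h.
Proof.
move=> a0 t0; case: h => [h| |]//; last by move=> _ _; rewrite leey.
rewrite lee_fin => h0 /(_ isT) H.
have := dual_transport_inequality_fin t0 H.
case: t t0 H => [t| |]// t0 H _.
move: a0; rewrite le_eqVlt => /predU1P[a0|a0].
  move: H; rewrite -a0 => /(dual_transport_inequality0 t0) ->.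
  by rewrite mul0e /= (class_C0 Calpha) lee_fin.
by rewrite inver gt_eqF// -EFinM /=; exact: dual_transport_inequality_le.
Qed.

Lemma le_monotone_inv_dual_transport (a h : R) (t : \bar R) (y : \bar R) :
  (0 <= a)%R -> 0 <= t -> (0 <= h)%R ->
  monotone_inv alpha h%:E <= y ->
  dual_transport_inequality a t h%:E -> t <= a%:E * y.
Proof.
move=> a0 t0 h0 yh H; have := dual_transport_inequality_fin t0 H.
case: t t0 H => [t| |]// t0 H _.
move: a0; rewrite le_eqVlt => /predU1P[a0|a0].
  by move: H; rewrite -a0 => /(dual_transport_inequality0 t0) ->; rewrite mul0e.
have := dual_transport_inequality_le a0 h0 t0 H => at_.
rewrite -(divfK (lt0r_neq0 a0) t) mulrC EFinM lee_wpmul2l ?lee_fin ?(ltW a0)//.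
apply: le_trans yh; apply: ereal_sup_ubound; exists (t / a)%R => //; split=> //.
by rewrite divr_ge0// ltW.
Qed.

End dual_transport_inequality.

(** * Sufficiency of the integral criterion *)

Section exponential_integrability.
Context {R : realType} {d : measure_display} {T : measurableType d}.
Variables (mu : probability T R) (alpha : R -> \bar R) (chi : T -> R).
Hypothesis Calpha : class_C alpha.
Hypotheses (mchi : measurable_fun setT chi) (chi0 : forall x, (0 <= chi x)%R).

Lemma measurable_expeR_class_C (l : R) : (0 <= l)%R ->
  measurable_fun setT (fun x => expeR (alpha (l * chi x)%R)).
Proof.
move=> l0.
have mh : measurable_fun setT (fun t : R => expeR (alpha (Num.max t 0%R))).
  apply: nondecreasing_emeasurable => s t st; rewrite lee_expeR.
  apply: (class_C_homo Calpha); first by rewrite le_max lexx orbT.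
  by rewrite ge_max !le_max st lexx !orbT.
have -> : (fun x => expeR (alpha (l * chi x)%R)) =
    (fun t : R => expeR (alpha (Num.max t 0%R))) \o (fun x => l * chi x)%R.
  by apply/funext => x /=; rewrite max_l// mulr_ge0.
by apply: measurableT_comp => //; exact: measurable_funM.
Qed.

Lemma integral_expeR_ge1 (l : R) : (0 <= l)%R ->
  1 <= \int[mu]_x expeR (alpha (l * chi x)%R).
Proof.
move=> l0; rewrite -[leLHS](integral_prob_cst mu 1).
apply: ge0_le_integral => //; first exact: measurable_expeR_class_C.
move=> x _; rewrite -expeR0 lee_expeR; apply: (class_C_ge0 Calpha).
  by rewrite mulr_ge0.
Qed.

Lemma integral_tau (l : R) : (0 <= l)%R ->
  \int[mu]_x expeR (alpha (l * chi x)%R) = \int[mu]_x (expeR (alpha (l * chi x)%R) - 1) + 1.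
Proof.
move=> l0; have e1 x : 1 <= expeR (alpha (l * chi x)%R).
  by rewrite -expeR0 lee_expeR; apply: (class_C_ge0 Calpha); rewrite mulr_ge0.
have t0 x : setT x -> 0 <= expeR (alpha (l * chi x)%R) - 1 by rewrite sube_ge0.
have mt : measurable_fun setT (fun x => expeR (alpha (l * chi x)%R) - 1).
  by apply: emeasurable_funB => //; exact: measurable_expeR_class_C.
have one0 (x : T) : setT x -> 0 <= (1 : \bar R) by move=> _; exact: lee01.
rewrite -[X in _ + X](integral_prob_cst mu 1).
rewrite -(ge0_integralD mu measurableT t0 mt one0 (measurable_cst _)).
by apply: eq_integral => x _; rewrite subeK.
Qed.

(** Rescaling by rho divides alpha by rho at least, and the integral of the
    power 1 / rho of exp(alpha) is at most M ^ (1 / rho) <= 2; Jensen's inequality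
    is replaced by a tangent of the exponential at ln M. *)
Lemma integral_expeR_rescale (delta M : R) : (0 < delta)%R ->
  \int[mu]_x expeR (alpha (delta * chi x)%R) = M%:E ->
  \int[mu]_x expeR (alpha (delta / (1 + ln M / ln 2) * chi x)%R) <= 2%:E.
Proof.
move=> d0 EM.
have M1 : (1 <= M)%R by rewrite -lee_fin -EM; apply: integral_expeR_ge1; exact: ltW.
have ln20 : (0 < ln 2 :> R)%R by rewrite ln_gt0//; lra.
have lnM0 : (0 <= ln M)%R by rewrite ln_ge0.
set rho := (1 + ln M / ln 2)%R.
have rho1 : (1 <= rho)%R by rewrite lerDl divr_ge0// ltW.
have rho0 : (0 < rho)%R by lra.
pose th := (rho^-1)%R.
have th0 : (0 < th)%R by rewrite invr_gt0.
have th1 : (th <= 1)%R by rewrite invf_le1.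
(* k is M ^ (1 / rho) *)
pose k := expR (th * ln M).
have k2 : (k <= 2)%R.
  rewrite -[leRHS](@lnK R 2%R) ?posrE// ler_expR /th ler_pdivrMl//.
  by rewrite /rho mulrDl mul1r divfK ?gt_eqF//; lra.
have k0 : (0 < k)%R by exact: expR_gt0.
have M0 : (0 < M)%R by lra.
have mexp : measurable_fun setT (fun x => expeR (alpha (delta * chi x)%R)).
  by apply: measurable_expeR_class_C; exact: ltW.
have kM0 : (0 <= k * th / M)%R by rewrite divr_ge0 ?mulr_ge0// ltW.
apply: (@le_trans _ _ (\int[mu]_x ((k * (1 - th))%:E +
    (k * th / M)%:E * expeR (alpha (delta * chi x)%R)))).
  have mexp' : measurable_fun setT (fun x => expeR (alpha (delta / rho * chi x)%R)).
    by apply: measurable_expeR_class_C; rewrite divr_ge0// ltW.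
  have mbound : measurable_fun setT (fun x => (k * (1 - th))%:E +
      (k * th / M)%:E * expeR (alpha (delta * chi x)%R)).
    by apply: emeasurable_funD => //; exact: measurable_funeM.
  apply: ge0_le_integral => //; first by move=> x _; exact: expeR_ge0.
  move=> x _.
  have dc0 : (0 <= delta * chi x)%R by rewrite mulr_ge0// ltW.
  have -> : (delta / rho * chi x = th * (delta * chi x))%R by rewrite /th; ring.
  apply: (@le_trans _ _ (expeR (th%:E * alpha (delta * chi x)%R))).
    by rewrite lee_expeR; apply: (class_C_scale Calpha) => //; rewrite (ltW th0).
  have := class_C_ge0 Calpha dc0; case: (alpha _) => [b| |]// _; last first.
    have kMp : (0 < k * th / M)%R by rewrite divr_gt0// mulr_gt0.
    by rewrite /= [in leRHS]gt0_muley ?lte_fin// addey// leey.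
  rewrite /= -EFinM -EFinD lee_fin.
  set z := (b - ln M)%R.
  have -> : (th * b = th * z + th * ln M)%R by rewrite /z; ring.
  have -> : expR b = (expR z * M)%R.
    have eM : expR (ln M) = M by rewrite lnK ?posrE.
    by rewrite -[X in (_ * X)%R]eM -expRD /z subrK.
  rewrite expRD -/k.
  have -> : (k * (1 - th) + k * th / M * (expR z * M) = k * (1 - th + th * expR z))%R.
    by field; rewrite gt_eqF.
  rewrite mulrC ler_pM2l//.
  (* average the tangents at th z, evaluated at z and at 0 *)
  have e1 := expR_ge1Dx ((1 - th) * z); have e2 := expR_ge1Dx (- (th * z)).
  have e0 := expR_gt0 (th * z).
  have -> : expR z = (expR (th * z) * expR ((1 - th) * z))%R by rewrite -expRD; congr expR; ring.
  have e3 : (expR (th * z) * expR (- (th * z)) = 1)%R by exact: expRxMexpNx_1.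
  have f1 : (expR (th * z) * (1 + (1 - th) * z) <= expR (th * z) * expR ((1 - th) * z))%R.
    by rewrite ler_pM2l.
  have f2 : (expR (th * z) * (1 - th * z) <= 1)%R by rewrite -[leRHS]e3 ler_pM2l.
  nra.
have kth0 : (0 <= k * (1 - th))%R by rewrite mulr_ge0 ?subr_ge0// ltW.
have cst0 (x : T) : setT x -> 0 <= (k * (1 - th))%:E by rewrite lee_fin.
have exp0 x : setT x -> 0 <= (k * th / M)%:E * expeR (alpha (delta * chi x)%R).
  by move=> _; rewrite mule_ge0 ?lee_fin ?expeR_ge0.
rewrite (ge0_integralD mu measurableT cst0 (measurable_cst _) exp0 (measurable_funeM _ mexp)).
rewrite (integral_prob_cst mu) ge0_integralZl//; last by move=> x _; exact: expeR_ge0.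
by rewrite EM -EFinM -EFinD lee_fin divfK ?gt_eqF//; lra.
Qed.

End exponential_integrability.

Section integral_criterion_sufficient.
Context {R : realType} {d : measure_display} {T : measurableType d}.
Variables (mu : probability T R) (c : T -> T -> R) (K : R) (alpha : R -> \bar R).
Hypothesis costc : cost_function c.
Hypothesis mc : measurable_fun setT (fun z : T * T => c z.1 z.2).
Hypothesis mcx : forall x, measurable_fun setT (c x).
Hypothesis c_tri : forall x0 x y, (c x y <= K / 2 * (c x0 x + c x0 y))%R.
Hypothesis cmu : forall x0, \int[mu]_x (c x0 x)%:E < +oo.
Hypothesis K_gt0 : (0 < K)%R.
Hypothesis Calpha : class_C alpha.
Hypothesis A1 : assumption_A1 alpha.
Variables (sa ca u : R).
Hypothesis A2 : assumption_A2 alpha sa ca.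
Hypothesis u01 : (0 < u < 1)%R.
Hypothesis u_sa : (u / Num.sqrt (1 - u) <= sa * Num.sqrt ca)%R.
Hypothesis u3 : (u ^+ 3 / (1 - u) <= 2)%R.

Let c0 x y : (0 <= c x y)%R. Proof. by case: costc. Qed.

Lemma transport_cost_ge0 (nu : probability T R) : 0 <= transport_cost c nu mu.
Proof.
apply: le_ereal_inf_tmp => _ [P _ <-]; apply: integral_ge0 => z _.
by rewrite lee_fin.
Qed.

(** The inverse of the conjugate at 2 is a positive real psi2, so the constant is
    a positive real; the properties of psi2 come along because the moment bounds
    are stated with it. *)
Lemma m_constE : exists m psi2 : R, [/\ (0 < m)%R, m_const alpha ca u = (expR 1 * m)%:E,
  m = Num.max (psi2 * Num.sqrt (ca * (1 - u)))^-1%R u^-1%R, (0 < psi2)%R &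
  monotone_conj alpha psi2 <= 2%:E /\
  forall s, (psi2 < s)%R -> 2%:E < monotone_conj alpha s].
Proof.
have [psi2 p0 [invE le2 gt2]] := monotone_inv_conj Calpha A1 A2 (ltr0n R 2).
have [u0 u1] := andP u01.
have ca0 : (0 < ca)%R by case: A2.
exists (Num.max (psi2 * Num.sqrt (ca * (1 - u)))^-1%R u^-1%R), psi2; split=> //.
- by rewrite lt_max !invr_gt0 u0 orbT.
- rewrite /m_const invE EFinM; congr (_ * _).
  rewrite -EFinM inver EFin_max gt_eqF// mulr_gt0// sqrtr_gt0 mulr_gt0// subr_gt0//.
Qed.

Lemma dual_transport_entropy (nu : probability T R) (x0 : T) (l : R) : (0 < l)%R ->
  \int[mu]_x expeR (alpha (l^-1 * c x0 x)%R) <= 2%:E ->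
  dual_transport_inequality alpha (Num.sqrt 2 * K * fine (m_const alpha ca u) * l)
    (transport_cost c nu mu) (relative_entropy nu mu).
Proof.
move=> l0 expl s L s0 sL.
have [m [psi2 [m0 mE mdef p0 [le2 gt2]]]] := m_constE.
rewrite mE /=; set M := (expR 1 * m)%R.
have M0 : (0 < M)%R by rewrite mulr_gt0// expR_gt0.
have L0 : (0 < L)%R by have := monotone_conj_gt0 A2 s0; rewrite sL.
have q20 : (0 < Num.sqrt 2 :> R)%R by rewrite sqrtr_gt0.
have a0 : (0 < Num.sqrt 2 * K * M * l)%R by rewrite !mulr_gt0.
have [numu|numu] := pselect (nu `<< mu); last first.
  rewrite /relative_entropy asboolF// addye// gt0_muley ?lte_fin ?leey//.
have [f [mf f0 fE ->]] := relative_entropyE numu.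
pose I := \int[mu]_x (c x0 x * `|f x - 1|)%:E.
have TI : transport_cost c nu mu <= (K / 2)%:E * I.
  apply: (transport_cost_le_weighted_variation mf f0 fE) => //.
  by rewrite divr_ge0// ltW.
(* the argument of the conjugate produced by the moment bound is then s *)
pose r := (s / (2 * Num.sqrt 2 * M * l))%R.
have r0 : (0 < r)%R by rewrite divr_gt0// !mulr_gt0.
have mexp : measurable_fun setT (fun x => expeR (alpha (l^-1 * c x0 x)%R)).
  by apply: measurable_expeR_class_C => //; rewrite invr_ge0 ltW.
have rI : r%:E * I <= \int[mu]_x (f x * ln (f x))%:E + L%:E.
  apply: (@weighted_transport_entropy _ _ _ mu f (c x0)
    (fun x => expeR (alpha (l^-1 * c x0 x)%R))) => //.
  - by rewrite -fE//= probability_setT.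
  - apply: ge0_integrable_fin (cmu x0); first exact/measurable_EFinP.
    by move=> x; rewrite /= lee_fin.
  - by move=> x; exact: expeR_ge0.
  move=> x; have -> : (2 * (r * c x0 x) = (2 * r * l) * (l^-1 * c x0 x))%R.
    by field; rewrite gt_eqF.
  apply: (expR_sub_le_conj Calpha A2 u01 u_sa u3 p0 le2 gt2).
  - by rewrite mulr_gt0// mulr_gt0.
  - by rewrite mulr_ge0// invr_ge0 ltW.
  rewrite -mdef -sL le_eqVlt; apply/orP; left; apply/eqP; congr (monotone_conj alpha _).
  by rewrite /r /M; field; rewrite !gt_eqF// expR_gt0.
apply: (@le_trans _ _ (s%:E * ((K / 2)%:E * I))).
  by rewrite lee_wpmul2l// lee_fin ltW.
have -> : s%:E * ((K / 2)%:E * I) = (Num.sqrt 2 * K * M * l)%:E * (r%:E * I).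
  rewrite !muleA -!EFinM; congr (_%:E * _).
  by rewrite /r; field; rewrite !gt_eqF.
by rewrite lee_wpmul2l// lee_fin ltW.
Qed.

Lemma luxemburg_dual_transport (nu : probability T R) (x0 : T) (l : R) : (0 < l)%R ->
  \int[mu]_x tau alpha (`|c x0 x| / l)%R <= 1 ->
  dual_transport_inequality alpha (Num.sqrt 2 * K * fine (m_const alpha ca u) * l)
    (transport_cost c nu mu) (relative_entropy nu mu).
Proof.
move=> l0 taul; apply: (@dual_transport_entropy _ x0) => //.
rewrite integral_tau//; last by rewrite invr_ge0 ltW.
have -> : 2%:E = 1 + 1 :> \bar R by rewrite -EFinD; congr (_%:E); ring.
rewrite leeD2r//; apply: le_trans taul.
rewrite le_eqVlt; apply/orP; left; apply/eqP; apply: eq_integral => x _.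
by rewrite /tau ger0_norm// mulrC.
Qed.

Let mconst_fin : m_const alpha ca u = (fine (m_const alpha ca u))%:E.
Proof. by have [m [psi2 [_ -> _ _ _]]] := m_constE. Qed.

Let mconst_gt0 : (0 < fine (m_const alpha ca u))%R.
Proof.
by have [m [psi2 [m0 -> _ _ _]]] := m_constE; rewrite /= mulr_gt0// expR_gt0.
Qed.

Let C := (Num.sqrt 2 * K * fine (m_const alpha ca u))%R.

Let C_gt0 : (0 < C)%R.
Proof. by rewrite !mulr_gt0// sqrtr_gt0. Qed.

Lemma orlicz_rescale (x0 : T) : orlicz mu alpha (c x0) ->
  exists2 l : R, (0 < l)%R & \int[mu]_x tau alpha (`|c x0 x| / l)%R <= 1.
Proof.
move=> [_ [l l0 tl]].
have tauE (k : R) : \int[mu]_x tau alpha (`|c x0 x| / k)%R =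
    \int[mu]_x (expeR (alpha (k^-1 * c x0 x)%R) - 1).
  by apply: eq_integral => x _; rewrite /tau ger0_norm// mulrC.
have l'0 : (0 < l^-1)%R by rewrite invr_gt0.
have : \int[mu]_x expeR (alpha (l^-1 * c x0 x)%R) < +oo.
  by rewrite integral_tau ?ltW// -tauE lte_add_pinfty// ltry.
have := @integral_expeR_ge1 _ _ _ mu alpha _ Calpha (mcx x0) (c0 x0) _ (ltW l'0).
case E : (\int[mu]_x expeR _) => [M| |]// M1 _.
have ln20 : (0 < ln 2 :> R)%R by rewrite ln_gt0//; lra.
have rho0 : (0 < 1 + ln M / ln 2)%R.
  by rewrite ltr_pwDl// divr_ge0 ?(ltW ln20)// ln_ge0// -lee_fin.
exists (l * (1 + ln M / ln 2))%R; first by rewrite mulr_gt0.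
have := integral_expeR_rescale Calpha (mcx x0) (c0 x0) l'0 E.
rewrite integral_tau//; last by rewrite divr_ge0// ltW.
rewrite tauE invfM => H.
by move: H; rewrite (_ : 2%:E = 1 + 1 :> \bar R) ?leeD2rE// -EFinD; congr (_%:E); ring.
Qed.

Lemma transport_inequality_of_luxemburg (x0 : T) (l : R) : (0 < l)%R ->
  \int[mu]_x tau alpha (`|c x0 x| / l)%R <= 1 ->
  transport_inequality mu alpha c (C * l)%:E.
Proof.
move=> l0 taul nu.
apply: (at_ereal_dual_transport Calpha (monotone_conj_fin_near0 Calpha A1)).
- by rewrite mulr_ge0// ltW.
- exact: transport_cost_ge0.
- exact: relative_entropy_ge0.
- by move=> _; exact: (@luxemburg_dual_transport _ x0).
Qed.

(** Taking the infimum in the dual form settles at once the cases where it is not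
    attained or equal to 0. *)
Lemma transport_inequality_inf_luxemburg :
  (forall x0, orlicz mu alpha (c x0)) ->
  let a := (Num.sqrt 2 * K)%:E * m_const alpha ca u * inf_luxemburg mu alpha c in
  a \is a fin_num /\ transport_inequality mu alpha c a.
Proof.
move=> orl a.
pose S := [set v : \bar R | exists x0, exists2 l : R, v = l%:E &
  (0 < l)%R /\ \int[mu]_x tau alpha (`|c x0 x| / l)%R <= 1].
have infS : inf_luxemburg mu alpha c = ereal_inf S.
  apply/eqP; rewrite eq_le; apply/andP; split; apply: le_ereal_inf_tmp.
    move=> _ [x0 [l -> Hl]].
    apply: (@le_trans _ _ (luxemburg mu alpha (c x0))); apply: ereal_inf_lbound.
      by exists x0.
    by exists l.
  move=> _ [x0 _ <-]; apply: le_ereal_inf_tmp => _ [l Hl <-].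
  by apply: ereal_inf_lbound; exists x0; exists l.
have S0 : S `<=` [set v | 0 <= v].
  by move=> _ [x0 [l -> [l0 _]]] /=; rewrite lee_fin ltW.
have inf0 : 0 <= ereal_inf S by exact: le_ereal_inf_tmp.
have [l0 Sl0] : exists l, S l%:E.
  by have [l ? ?] := orlicz_rescale (orl point); exists l; exists point; exists l.
have : ereal_inf S <= l0%:E by exact: ereal_inf_lbound.
rewrite /a infS mconst_fin -EFinM -/C.
case E : (ereal_inf S) inf0 => [r| |]// r0 _; split=> // nu.
rewrite -EFinM.
apply: (at_ereal_dual_transport Calpha (monotone_conj_fin_near0 Calpha A1)).
- by rewrite mulr_ge0// ltW.
- exact: transport_cost_ge0.
- exact: relative_entropy_ge0.
have := relative_entropy_ge0 nu mu; case Eh : (relative_entropy nu mu) => [h| |]// h0 _.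
apply: (dual_transport_inequality_inf (monotone_conj_gt0 A2) C_gt0 _ _ E) => //.
- exact: transport_cost_ge0.
- move=> v [x0 [l [->] [l_gt0 taul]]]; rewrite -Eh.
  exact: (@luxemburg_dual_transport _ x0).
Qed.

Lemma transport_cost_le_inf_exp_moment (nu : probability T R) :
  transport_cost c nu mu <= (Num.sqrt 2 * K)%:E * m_const alpha ca u *
    mul_top (inf_exp_moment mu alpha c) (monotone_inv alpha (relative_entropy nu mu)).
Proof.
rewrite mconst_fin -EFinM -/C /mul_top.
case: ifPn => [_|]; first by rewrite gt0_muley ?lte_fin// leey.
rewrite negb_or => /andP[infy invy].
have ln20 : (0 < ln 2 :> R)%R by rewrite ln_gt0//; lra.
set S := [set (p.2^-1)%:E * (1 + lne (\int[mu]_x expeR (alpha (p.2 * c p.1 x)%R)) / (ln 2)%:E)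
    | p in [set p : T * R | (0 < p.2)%R]].
have Sval v : S v -> v = +oo \/ exists x0 delta M, [/\ (0 < delta)%R, (1 <= M)%R,
    \int[mu]_x expeR (alpha (delta * c x0 x)%R) = M%:E &
    v = (delta^-1 * (1 + ln M / ln 2))%:E].
  move=> [[x0 delta] /= d0 <-].
  have := @integral_expeR_ge1 _ _ _ mu alpha _ Calpha (mcx x0) (c0 x0) _ (ltW d0).
  case E : (\int[mu]_x expeR _) => [M| |]// M1; last first.
    left; rewrite inver gt_eqF// mulyr gtr0_sg ?invr_gt0// mul1e addey//.
    by rewrite gt0_muley// lte_fin invr_gt0.
  right; have {}M1 : (1 <= M)%R by rewrite -lee_fin.
  exists x0, delta, M; split=> //.
  have M0 : (0 < M)%R by rewrite (lt_le_trans _ M1).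
  by rewrite lne_EFin// inver gt_eqF.
have S0 : S `<=` [set v | 0 <= v].
  move=> v /Sval[->|[x0 [delta [M [d0 M1 _ ->]]]]] /=; first by rewrite leey.
  rewrite lee_fin mulr_ge0 ?invr_ge0 ?(ltW d0)// addr_ge0// divr_ge0 ?(ltW ln20)//.
  by rewrite ln_ge0.
have inf0 : 0 <= ereal_inf S by exact: le_ereal_inf_tmp.
have H0 := relative_entropy_ge0 nu mu.
case Eh : (relative_entropy nu mu) H0 invy => [h| |]// h0 invy; last first.
  exfalso; move/negP: invy; apply; apply/eqP; apply/eqyP => A A0.
  by apply: ereal_sup_ubound; exists A; rewrite ?leey//; split; rewrite ?leey// ltW.
rewrite -/(inf_exp_moment mu alpha c) in inf0 *.
case E : (inf_exp_moment mu alpha c) inf0 infy => [r| |]// r0 _.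
rewrite muleA -EFinM.
apply: (le_monotone_inv_dual_transport Calpha (monotone_conj_fin_near0 Calpha A1) _ _ h0) => //.
- by rewrite mulr_ge0// ltW.
- exact: transport_cost_ge0.
apply: (dual_transport_inequality_inf (monotone_conj_gt0 A2) C_gt0 _ h0 E _ S0).
- exact: transport_cost_ge0.
move=> v /Sval[//|[x0 [delta [M [d0 M1 EM [->]]]]]]; rewrite -Eh.
have rho0 : (0 < 1 + ln M / ln 2)%R.
  by rewrite ltr_pwDl// divr_ge0 ?(ltW ln20)// ln_ge0.
apply: (@dual_transport_entropy _ x0); first by rewrite mulr_gt0// invr_gt0.
by rewrite invfM invrK; exact: integral_expeR_rescale.
Qed.

End integral_criterion_sufficient.

(** * Conditioning and coercivity *)

Section coercivity.
Context {R : realType}.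
Variable alpha : R -> \bar R.
Hypothesis Calpha : class_C alpha.
Hypothesis A1 : assumption_A1 alpha.

(** The slope is any point where the conjugate is finite. *)
Lemma class_C_ge_affine : exists2 s : R, (0 < s)%R &
  exists2 L : R, (0 <= L)%R & forall t, (0 <= t)%R -> (s * t - L)%:E <= alpha t.
Proof.
have [s s0 [L L0 sL]] := monotone_conj_fin_near0 Calpha A1.
exists s => //; exists L => // t t0.
have := fenchel_young alpha s t0; rewrite sL.
have := class_C_ge0 Calpha t0; case: (alpha t) => [x| |]// _; last by rewrite leey.
by rewrite -EFinB !lee_fin; lra.
Qed.

Lemma class_C_cvg_pinfty : alpha t @[t --> +oo%R] --> +oo.
Proof.
have [s s0 [L L0 aff]] := class_C_ge_affine.
apply/cvgeyPge => B.
have : \forall t \near +oo%R, (Num.max 0 ((B + L) / s) <= t)%R.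
  by apply: nbhs_pinfty_ge; exact: num_real.
apply: filterS => t; rewrite ge_max => /andP[t0].
rewrite ler_pdivrMr// => Bt; apply: le_trans (aff _ t0).
by rewrite lee_fin; lra.
Qed.

Lemma at_ereal_homo (t : R) (y : \bar R) : (0 <= t)%R -> t%:E <= y ->
  alpha t <= at_ereal alpha y.
Proof.
move=> t0; case: y => [r| |]//; first by rewrite lee_fin; exact: class_C_homo.
by move=> _; rewrite /= (cvg_lim _ class_C_cvg_pinfty)// leey.
Qed.

End coercivity.

Section conditional_probability.
Context {R : realType} {d : measure_display} {T : measurableType d}.
Variables (mu : probability T R) (A : set T).
Hypotheses (mA : measurable A) (muA : mu A != 0).

Definition conditional_probability : probability T R :=
  mnormalize (mrestr mu mA) mu.

Let g : R := fine (mu A).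

Let gE : mu A = g%:E. Proof. by rewrite /g fineK// fin_num_measure. Qed.

Let g0 : (0 < g)%R.
Proof. by rewrite -lte_fin -gE lt_neqAle eq_sym muA measure_ge0. Qed.

Lemma conditional_probabilityE B : conditional_probability B = mu (B `&` A) * (g^-1)%:E.
Proof.
rewrite -[LHS]/(mnormalize (mrestr mu mA) mu B) /mnormalize.
have e0 : mrestr mu mA setT != 0 by rewrite /mrestr setTI.
have ey : mrestr mu mA setT != +oo by rewrite /mrestr setTI gE.
by rewrite /= (negbTE e0) (negbTE ey)/= /mrestr setTI.
Qed.

(** Conditioning costs the information content of the event. *)
Lemma relative_entropy_conditional :
  relative_entropy conditional_probability mu = (- ln g)%:E.
Proof.
have numu : conditional_probability `<< mu.
  apply/null_content_dominatesP => B mB muB; rewrite conditional_probabilityE.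
  rewrite (_ : mu (B `&` A) = 0) ?mul0e//; apply/eqP.
  by rewrite eq_le measure_ge0 andbT -muB le_measure// inE//; exact: measurableI.
have [f [mf f0 fE ->]] := relative_entropyE numu.
pose h x := (g^-1 * \1_A x)%R.
have mh : measurable_fun setT h by apply: measurable_funM => //; exact: measurable_indic.
have fh : ae_eq mu setT (EFin \o f) (EFin \o h).
  apply: integral_ae_eq => //.
  - apply: ge0_integrable_fin; [exact/measurable_EFinP| |].
      by move=> x; rewrite /= lee_fin.
    by rewrite /= -fE//= probability_setT ltry.
  - exact/measurable_EFinP.
  move=> B _ mB; rewrite /= -fE// conditional_probabilityE.
  under [RHS]eq_integral do rewrite EFinM.
  rewrite ge0_integralZl//.
  - by rewrite integral_indic// setIC muleC.
  - by apply/measurable_EFinP; exact/measurable_funTS/measurable_indic.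
  - by rewrite lee_fin invr_ge0 ltW.
transitivity (\int[mu]_x ((g^-1 * ln g^-1)%:E * (\1_A x)%:E)).
  apply: ae_eq_integral => //.
  - apply/measurable_EFinP; apply: measurable_funM => //; exact: measurableT_comp.
  - by apply: measurable_funeM; apply/measurable_EFinP; exact: measurable_indic.
  have := ae_eq_comp (fun y : \bar R => (fine y * ln (fine y))%:E) fh.
  apply: filterS => x + _ => /(_ Logic.I) /= ->.
  rewrite /h indicE; case: (x \in A); first by rewrite !mulr1 mule1.
  by rewrite !mulr0 mul0r mule0.
rewrite integralZl//; last exact: integrable_indic.
rewrite integral_indic//= setIT gE -EFinM; congr (_%:E).
by rewrite lnV ?posrE//; field; rewrite gt_eqF.
Qed.

End conditional_probability.

(** * Necessity of the integral criterion *)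

Section integral_criterion_necessary.
Context {R : realType} {d : measure_display} {T : measurableType d}.
Variables (mu : probability T R) (c : T -> T -> R) (K : R) (alpha : R -> \bar R).
Hypothesis costc : cost_function c.
Hypothesis mc : measurable_fun setT (fun z : T * T => c z.1 z.2).
Hypothesis mcx : forall x, measurable_fun setT (c x).
Hypothesis c_sym : forall x y, c x y = c y x.
Hypothesis c_tri : forall x y z, (c x z <= K / 2 * (c x y + c y z))%R.
Hypothesis cmu : forall x0, \int[mu]_x (c x0 x)%:E < +oo.
Hypothesis K_gt0 : (0 < K)%R.
Hypothesis Calpha : class_C alpha.
Hypothesis A1 : assumption_A1 alpha.
Variables (sa ca : R).
Hypothesis A2 : assumption_A2 alpha sa ca.
Variables (a : R) (x0 : T).
Hypothesis a_gt0 : (0 < a)%R.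
Hypothesis Ta : transport_inequality mu alpha c a%:E.

Let c0 x y : (0 <= c x y)%R. Proof. by case: costc. Qed.

Let M : R := fine (\int[mu]_x (c x0 x)%:E).

Let ME : \int[mu]_x (c x0 x)%:E = M%:E.
Proof.
rewrite /M fineK// ge0_fin_numE ?cmu//.
by apply: integral_ge0 => x _; rewrite lee_fin.
Qed.

Let M0 : (0 <= M)%R.
Proof. by rewrite -lee_fin -ME; apply: integral_ge0 => x _; rewrite lee_fin. Qed.

(** Under any coupling the first point is at cost at least t from x0, hence at
    cost at least 2 t / K - c(x0, y) from the second point y. *)
Lemma transport_cost_ge_far (nu : probability T R) (t : R) : (0 <= t)%R ->
  nu [set x | (t <= c x0 x)%R] = 1 ->
  (2 * t / K - M)%:E <= transport_cost c nu mu.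
Proof.
move=> t0 nuA; set A := [set x | _] in nuA.
have mA : measurable A.
  have := mcx x0 measurableT (measurable_itv `[t, +oo[).
  by rewrite setTI; congr measurable; apply/seteqP; split=> x /=; rewrite in_itv/= andbT.
apply: le_ereal_inf_tmp => _ [P Pc <-].
have Ec0 (z : T * T) : setT z -> 0 <= (c z.1 z.2)%:E by rewrite lee_fin.
have mEc : measurable_fun setT (fun z : T * T => (c z.1 z.2)%:E) by exact/measurable_EFinP.
have chi0 (z : T * T) : setT z -> 0 <= (c x0 z.2)%:E by rewrite lee_fin.
have mchi : measurable_fun setT (EFin \o c x0) by exact/measurable_EFinP.
have mchi2 : measurable_fun setT (fun z : T * T => (c x0 z.2)%:E).
  by apply/measurable_EFinP; exact: measurableT_comp.
have chi_int : \int[P]_z (c x0 z.2)%:E = M%:E.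
  rewrite -ME.
  have := ge0_integral_pushforward (@measurable_snd _ _ T T) P measurableT mchi
    (fun y _ => _ : 0 <= (EFin \o c x0) y).
  rewrite preimage_setT /= => <-; last by move=> y; rewrite lee_fin.
  by apply: eq_measure_integral => B mB _; have [_ PB] := Pc B mB; exact: PB.
have tK0 : (0 <= 2 * t / K)%R by rewrite divr_ge0 ?mulr_ge0// ltW.
have PA : P (fst @^-1` A) = 1 by have [-> _] := Pc A mA.
have mfA : measurable (fst @^-1` A : set (T * T)).
  by rewrite -[X in measurable X]setTI; exact: measurable_fst.
have : (2 * t / K)%:E <= \int[P]_z ((c z.1 z.2)%:E + (c x0 z.2)%:E).
  have -> : (2 * t / K)%:E = \int[P]_z ((2 * t / K)%:E * (\1_(fst @^-1` A) z)%:E).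
    rewrite ge0_integralZl//.
    - by rewrite integral_indic//= setIT PA mule1.
    - by apply/measurable_EFinP; exact: measurable_indic.
  have mind : measurable_fun setT (fun z : T * T => (2 * t / K)%:E * (\1_(fst @^-1` A) z)%:E).
    by apply: measurable_funeM; apply/measurable_EFinP; exact: measurable_indic.
  have msum : measurable_fun setT (fun z : T * T => (c z.1 z.2)%:E + (c x0 z.2)%:E).
    exact: emeasurable_funD.
  apply: ge0_le_integral => //.
    by move=> z _; rewrite -EFinM lee_fin mulr_ge0.
  move=> [x y] _ /=; rewrite -EFinM -EFinD lee_fin indicE.
  case: (boolP (_ \in _)) => [|_]; last by rewrite mulr0 addr_ge0.
  rewrite inE /A /= => tx; rewrite mulr1 ler_pdivrMr//.
  by have := c_tri x0 y x; rewrite (c_sym y x); lra.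
rewrite (ge0_integralD P measurableT Ec0 mEc chi0 mchi2) chi_int.
by rewrite EFinB leeBlDr.
Qed.

Let far (n : nat) (D : R) : set T := [set x | (n%:R * D <= c x0 x)%R].

Let measurable_far n D : measurable (far n D).
Proof.
have := mcx x0 measurableT (measurable_itv `[(n%:R * D)%R, +oo[).
by rewrite setTI; congr measurable; apply/seteqP; split=> x /=; rewrite in_itv/= andbT.
Qed.

(** The transport inequality, applied to mu conditioned on being far from x0. *)
Lemma class_C_le_ln_far (D : R) (n : nat) : (0 < D)%R -> (K * M <= D)%R -> (K * a <= D)%R ->
  mu (far n D) != 0 -> alpha n%:R <= (- ln (fine (mu (far n D))))%:E.
Proof.
move=> D0 DM Da muA.
have [n0|n0] := posnP n.
  have g0 : 0 < mu (far n D) by rewrite lt_neqAle eq_sym muA measure_ge0.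
  have g1 : mu (far n D) <= 1 by exact: probability_le1.
  rewrite {1}n0 (class_C0 Calpha) lee_fin oppr_ge0 ln_le0//.
  by rewrite -lee_fin fineK// fin_num_measure.
have n1 : (1 <= n%:R :> R)%R by rewrite ler1n.
pose t := (n%:R * D)%R.
have t0 : (0 <= t)%R by rewrite mulr_ge0// ltW.
pose nu := conditional_probability mu (measurable_far n D).
have nu1 : nu [set x | (t <= c x0 x)%R] = 1.
  rewrite (conditional_probabilityE (measurable_far n D) muA) -/(far n D) setIid.
  rewrite -[X in X * _]fineK ?fin_num_measure//.
  by rewrite -EFinM divff// fine_eq0// fin_num_measure.
have Tt := transport_cost_ge_far t0 nu1.
rewrite -(@relative_entropy_conditional _ _ _ mu _ (measurable_far n D) muA).
apply: le_trans (Ta _).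
apply: (at_ereal_homo Calpha A1) => //.
rewrite inver gt_eqF//.
have t_le : (n%:R <= (2 * t / K - M) / a)%R.
  rewrite ler_pdivlMr// lerBrDr ler_pdivlMr// /t.
  have : (n%:R * (K * a) <= n%:R * D)%R by rewrite ler_pM2l// (lt_le_trans ltr01).
  have : (K * M <= n%:R * D)%R by apply: le_trans DM _; rewrite ler_peMl// ltW.
  lra.
apply: le_trans (_ : ((2 * t / K - M) / a)%:E <= _); first by rewrite lee_fin.
by rewrite EFinM lee_wpmul2r// lee_fin invr_ge0 ltW.
Qed.

(** On the shell n D <= chi < (n + 1) D, alpha of the rescaled cost is at most
    alpha n / 2, while the set chi >= n D has mass at most exp (- alpha n); as
    alpha grows at least linearly, the products are summable. *)
Lemma orlicz_of_transport_inequality : orlicz mu alpha (c x0).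
Proof.
split; first exact: mcx.
have [t0 t00 [e e0 te]] := class_C_fin_near0 Calpha A2.
have [s s0 [L L0 aff]] := class_C_ge_affine Calpha A1.
(* at distance n D the mean M costs at most half of 2 n D / K *)
pose D := (K * M + K * a)%R.
have D0 : (0 < D)%R by rewrite ltr_wpDl ?mulr_gt0// mulr_ge0// ltW.
have DM : (K * M <= D)%R by rewrite lerDl mulr_ge0// ltW.
have Da : (K * a <= D)%R by rewrite lerDr mulr_ge0// ltW.
(* th <= t0 keeps alpha finite on the first shell, th <= 1 / 4 gives
   th (n + 1) <= n / 2 on the others *)
pose th := Num.min t0 (4^-1)%R.
have th0 : (0 < th)%R by rewrite lt_min t00/=.
exists (D / th)%R; first by rewrite divr_gt0.
have l0 : (0 <= th / D)%R by rewrite divr_ge0// ltW.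
pose F n x := expeR (2^-1%:E * alpha n%:R) * (\1_(far n D) x)%:E.
have F0 n x : 0 <= F n x by rewrite mule_ge0 ?expeR_ge0 ?lee_fin.
have mF n : measurable_fun setT (F n).
  by apply: measurable_funeM; apply/measurable_EFinP; exact: measurable_indic.
have pointwise x : expeR (alpha (th / D * c x0 x)%R) <= (expR e)%:E + \sum_(n <oo) F n x.
  have chiD0 : (0 <= c x0 x / D)%R by rewrite divr_ge0// ltW.
  have /andP[nle ltn1] := truncn_itv chiD0.
  set n := Num.truncn _ in nle ltn1.
  have sum0 : 0 <= \sum_(n <oo) F n x by apply: nneseries_ge0 => k _ _; exact: F0.
  have thE : (th / D * c x0 x = th * (c x0 x / D))%R by ring.
  have [n0|n0] := posnP n.
    apply: (@le_trans _ _ (expR e)%:E); last by rewrite leeDl.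
    rewrite -[leRHS]/(expeR e%:E) lee_expeR -te; apply: (class_C_homo Calpha).
      by rewrite mulr_ge0.
    rewrite thE; apply: (@le_trans _ _ th); last by rewrite ge_min lexx.
    by rewrite ler_piMr ?(ltW th0)//; move: ltn1; rewrite n0 => /ltW.
  apply: (@le_trans _ _ (F n x)).
    have xfar : x \in far n D by rewrite inE /far/= -ler_pdivlMr.
    rewrite /F indicE xfar mule1 lee_expeR.
    have n2 : (0 <= (2^-1 : R) <= 1)%R by apply/andP; split; lra.
    apply: le_trans _ (class_C_scale Calpha (ler0n R n) n2).
    apply: (class_C_homo Calpha); first by rewrite mulr_ge0.
    rewrite thE.
    have n1 : (1 <= n%:R :> R)%R by rewrite ler1n.
    have th4 : (th <= 4^-1)%R by rewrite ge_min lexx orbT.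
    have : (th * (c x0 x / D) <= 4^-1 * (c x0 x / D))%R by rewrite ler_wpM2r.
    move: ltn1; rewrite -natr1; lra.
  apply: (@le_trans _ _ (\sum_(n <oo) F n x)); last first.
    by rewrite leeDr// lee_fin expR_ge0.
  apply: le_trans (nneseries_lim_ge n.+1 _); last by move=> k _ _; exact: F0.
  by rewrite big_nat_recr//= leeDr// sume_ge0.
have intF n : \int[mu]_x F n x <= (expR (L / 2) * expR (- (s / 2)) ^+ n)%:E.
  rewrite ge0_integralZl//; [| |exact: expeR_ge0]; last first.
    by apply/measurable_EFinP; exact: measurable_indic.
  rewrite integral_indic//= setIT.
  have [->|muA] := eqVneq (mu (far n D)) 0.
    by rewrite mule0 lee_fin mulr_ge0 ?exprn_ge0 ?expR_ge0.
  have := class_C_le_ln_far D0 DM Da muA; set g := fine _ => ag.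
  have gE : mu (far n D) = g%:E by rewrite /g fineK// fin_num_measure.
  have g0 : (0 < g)%R by rewrite -lte_fin -gE lt_neqAle eq_sym muA measure_ge0.
  have := aff n%:R (ler0n _ _); rewrite gE.
  case: (alpha n%:R) ag => [x| |]// ag; rewrite lee_fin => sx.
  rewrite /= -EFinM lee_fin -expRM_natl -expRD.
  have -> : g = expR (ln g) by rewrite lnK ?posrE.
  by rewrite -expRD ler_expR; move: ag; rewrite lee_fin; lra.
have sumF : \sum_(n <oo) \int[mu]_x F n x < +oo.
  have r1 : (expR (- (s / 2)) < 1)%R by rewrite expR_lt1 oppr_lt0 divr_gt0.
  apply: (@le_lt_trans _ _ (expR (L / 2) * (1 / (1 - expR (- (s / 2)))))%:E); last by rewrite ltry.
  apply: lime_le.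
    by apply: is_cvg_nneseries => n _ _; apply: integral_ge0 => x _; exact: F0.
  apply: nearW => n.
  apply: (@le_trans _ _ (\sum_(0 <= i < n) (expR (L / 2) * expR (- (s / 2)) ^+ i)%:E)).
    by apply: lee_sum => i _; exact: intF.
  rewrite sumEFin lee_fin -big_distrr/= ler_pM2l ?expR_gt0//.
  by rewrite -(expr0 (expR (- (s / 2)))); apply: geometric_tail_le => //; exact: expR_ge0.
have mexp := measurable_expeR_class_C Calpha (mcx x0) (c0 x0) l0.
have : \int[mu]_x expeR (alpha (th / D * c x0 x)%R) < +oo.
  apply: (@le_lt_trans _ _ (\int[mu]_x ((expR e)%:E + \sum_(n <oo) F n x))).
    apply: ge0_le_integral => //.
    - by move=> x _; exact: expeR_ge0.
    - apply: emeasurable_funD => //.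
      by apply: ge0_emeasurable_sum => // n x _ _; exact: F0.
  have cst0 (x : T) : setT x -> 0 <= (expR e)%:E by rewrite lee_fin expR_ge0.
  have sum0 (x : T) : setT x -> 0 <= \sum_(n <oo) F n x.
    by move=> _; apply: nneseries_ge0 => k _ _; exact: F0.
  have msum : measurable_fun setT (fun x => \sum_(n <oo) F n x).
    by apply: ge0_emeasurable_sum => // n x _ _; exact: F0.
  rewrite (ge0_integralD mu measurableT cst0 (measurable_cst _) sum0 msum).
  rewrite (integral_prob_cst mu) integral_nneseries//.
  by rewrite lte_add_pinfty// ltry.
rewrite (integral_tau mu Calpha (mcx x0) (c0 x0) l0).
move=> H; apply: le_lt_trans H.
apply: (@le_trans _ _ (\int[mu]_x (expeR (alpha (th / D * c x0 x)%R) - 1))).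
  rewrite le_eqVlt; apply/orP; left; apply/eqP; apply: eq_integral => x _.
  by rewrite /tau ger0_norm// invf_div mulrC.
by rewrite leeDl.
Qed.

End integral_criterion_necessary.

(** * The integral criterion *)

Lemma exists_m_const_parameter {R : realType} (e : R) : (0 < e)%R ->
  exists2 u : R, (0 < u < 1)%R &
    (u / Num.sqrt (1 - u) <= e)%R /\ (u ^+ 3 / (1 - u) <= 2)%R.
Proof.
move=> e0; pose u := Num.min (2^-1)%R (e / 2)%R.
have u0 : (0 < u)%R by rewrite lt_min divr_gt0//= andbT.
have u2 : (u <= 2^-1)%R by rewrite ge_min lexx.
have ue : (u <= e / 2)%R by rewrite ge_min lexx orbT.
exists u; first by apply/andP; split=> //; lra.
split; last by rewrite ler_pdivrMr; [nra|lra].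
have q : (2^-1 <= Num.sqrt (1 - u))%R.
  have h0 : (0 <= 2^-1 :> R)%R by lra.
  by rewrite -(ger0_norm h0) -sqrtr_sqr ler_sqrt; [nra|lra].
rewrite ler_pdivrMr; last by apply: lt_le_trans q; rewrite invr_gt0.
nra.
Qed.

Theorem theorem1p14 (R : realType) (X : completeMetricType R)
    (sepX : separable X)
    (q : R -> R) (c : borel X -> borel X -> R)
    (costc : cost_function c)
    (cE : forall x y : X, c x y = q (mdist x y))
    (q_ge0 : forall t : R, (0 <= t)%R -> (0 <= q t)%R)
    (q_incr : forall s t : R, (0 <= s)%R -> (s <= t)%R -> (q s <= q t)%R)
    (q_convex : convex_function [set t : R | (0 <= t)%R] q)
    (K : R) (K_gt0 : (0 < K)%R)
    (q_Delta2 : forall t : R, (0 <= t)%R -> (q (2 * t) <= K * q t)%R)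
    (alpha : R -> \bar R) (Calpha : class_C alpha)
    (A1 : assumption_A1 alpha)
    (sa ca : R) (A2 : assumption_A2 alpha sa ca)
    (mu : probability (borel X) R)
    (cmu : forall x0 : X, \int[mu]_x (c x0 x)%:E < +oo) :
  ((exists2 a : R, (0 < a)%R & transport_inequality mu alpha c a%:E)
   <-> (forall x0 : X, orlicz mu alpha (c x0)))
  /\
  (forall u : R, (0 < u < 1)%R ->
     (u / Num.sqrt (1 - u) <= sa * Num.sqrt ca)%R ->
     (u ^+ 3 / (1 - u) <= 2)%R ->
     ((forall x0 : X, orlicz mu alpha (c x0)) ->
        let a := (Num.sqrt 2 * K)%:E * m_const alpha ca u
                   * inf_luxemburg mu alpha c in
        a \is a fin_num /\ transport_inequality mu alpha c a)
     /\
     (edom alpha = [set t : R | (0 <= t)%R] ->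
        forall nu : probability (borel X) R,
          transport_cost c nu mu <=
            (Num.sqrt 2 * K)%:E * m_const alpha ca u *
            mul_top (inf_exp_moment mu alpha c)
                    (monotone_inv alpha (relative_entropy nu mu)))).
Proof.
have c_sym : forall x y, c x y = c y x by exact: (metric_cost_sym cE).
have c_tri : forall x y z, (c x z <= K / 2 * (c x y + c y z))%R.
  exact: (metric_cost_triangle cE q_incr q_convex q_Delta2).
have c_tri0 x0 x y : (c x y <= K / 2 * (c x0 x + c x0 y))%R.
  by rewrite (c_sym x0 x); exact: c_tri.
have mc := measurable_metric_cost cE q_incr sepX.
have mcx := measurable_metric_cost_from cE q_incr.
split; last first.
  move=> u u01 u_sa u3; split.
    exact: (transport_inequality_inf_luxemburg costc mc mcx c_tri0 cmu K_gt0
      Calpha A1 A2 u01 u_sa u3).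
  move=> _ nu.
  exact: (transport_cost_le_inf_exp_moment costc mc mcx c_tri0 cmu K_gt0
    Calpha A1 A2 u01 u_sa u3).
split=> [[a a0 Ta] x0|orl].
  exact: (orlicz_of_transport_inequality costc mc mcx c_sym c_tri cmu K_gt0
    Calpha A1 A2 x0 a0 Ta).
have [sa0 ca0 _] := A2.
have [u u01 [u_sa u3]] : exists2 u : R, (0 < u < 1)%R &
    (u / Num.sqrt (1 - u) <= sa * Num.sqrt ca)%R /\ (u ^+ 3 / (1 - u) <= 2)%R.
  by apply: exists_m_const_parameter; rewrite mulr_gt0// sqrtr_gt0.
have [l l0 taul] := orlicz_rescale costc mcx Calpha (orl point).
have := transport_inequality_of_luxemburg costc mc mcx c_tri0 cmu K_gt0
  Calpha A1 A2 u01 u_sa u3 l0 taul.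
have [m [psi2 [m0 -> _ _ _]]] := m_constE Calpha A1 A2 u01.
move=> Ta; eexists; last exact: Ta.
by rewrite !mulr_gt0// ?sqrtr_gt0// expR_gt0.
Qed.
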